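(* Let $X=(X_1,\ldots,X_n)$ be i.i.d. mean zero real random variables with variance $\sigma^2$ and $\mathrm{E}|X_i|^3=\omega<\infty$. Let $\theta_1,\ldots,\theta_n\in\mathbb{R}$ satisfy $\sum_{i=1}^n\theta_i^2=1$, let $T:\mathbb{R}^n\to\mathbb{R}$ be $T(x)=\sum_{i=1}^n\theta_ix_i$, and let $G=\{-1,+1\}^n$ act on $\mathbb{R}^n$ by $\pi_gx=(g_1x_1,\ldots,g_nx_n)$, with $\rho$ the uniform probability measure on $G$. Then, for some universal constant $C>0$ and for all $t\in\mathbb{R}$, $$\Big|\mathrm{P}(T(X)>t)-\mathrm{E}_X\,\rho\big(\{g\in G: T(\pi_gX)>t\}\big)\Big|\le\frac{2C\omega}{\sigma^3}\sum_{i=1}^n|\theta_i|^3.$$ Furthermore, if $\sum_{i=1}^n|\theta_i|^3\to0$ as $n\to\infty$ (the weights $\theta_i$ being allowed to depend on $n$), then the two probabilities coincide asymptotically, i.e. the left hand side tends to $0$. In particular, if $\theta_1=\cdots=\theta_n=n^{-1/2}$, then the right hand side is $O(n^{-1/2})$.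
   Context: $\mathrm{E}_X$ denotes expectation with respect to $X$. The uniform probability measure $\rho$ is normalized Haar measure on the finite group $G$. *)

(* Defs.v *)
From HB Require Import structures.
From mathcomp Require Import all_boot all_order all_algebra all_fingroup.
From mathcomp Require Import all_classical all_reals all_analysis.

Set Implicit Arguments.
Unset Strict Implicit.
Unset Printing Implicit Defensive.

Import Order.TTheory GRing.Theory Num.Theory.
Import numFieldNormedType.Exports.

Local Open Scope classical_set_scope.
Local Open Scope ring_scope.

Definition mutually_independent d (Omega : measurableType d) (R : realType)
    (P : probability Omega R) (n : nat) (X : 'I_n -> {RV P >-> R}) : Prop :=
  forall (J : {set 'I_n}) (A : 'I_n -> set R),
    (forall i, measurable (A i)) ->
    P (\bigcap_(i in [set` J]) (X i @^-1` A i)) =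
      (\prod_(i in J) P (X i @^-1` A i))%E.

Arguments mutually_independent {d Omega R} P {n} X.

Definition identically_distributed d (Omega : measurableType d) (R : realType)
    (P : probability Omega R) (n : nat) (X : 'I_n -> {RV P >-> R}) : Prop :=
  forall (i j : 'I_n) (A : set R), measurable A ->
    distribution P (X i) A = distribution P (X j) A.

Arguments identically_distributed {d Omega R} P {n} X.

Definition iid_centered d (Omega : measurableType d) (R : realType)
    (P : probability Omega R) (n : nat) (X : 'I_n -> {RV P >-> R})
    (sigma omega : R) : Prop :=
  [/\ mutually_independent P X,
      identically_distributed P X,
      forall i, ('E_P[X i] = 0)%E,
      forall i, ('V_P[X i] = (sigma ^+ 2)%:E)%E
    & forall i, ('E_P[(fun w => `|X i w| ^+ 3)%R] = omega%:E)%E].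

Arguments iid_centered {d Omega R} P {n} X sigma omega.

Definition rvec (R : realType) (Omega : Type) (n : nat)
  (X : 'I_n -> Omega -> R) (w : Omega) : 'rV[R]_n := \row_i X i w.

Definition lin_stat (R : realType) (n : nat) (theta x : 'rV[R]_n) : R :=
  \sum_(i < n) theta 0 i * x 0 i.

(* The group {-1,+1}^n, each factor being encoded additively as 'Z_2: the
   exponent e : 'Z_2 stands for the sign (-1)^e. *)
Definition signs (n : nat) := {dffun forall _ : 'I_n, 'Z_2}.

Definition sign_act (R : realType) (n : nat) (g : signs n) (x : 'rV[R]_n) :
  'rV[R]_n := \row_i ((-1) ^+ g i * x 0 i).

Lemma sign_actM (R : realType) (n : nat) (g h : signs n) (x : 'rV[R]_n) :
  sign_act (g * h)%g x = sign_act g (sign_act h x).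
Proof.
apply/rowP => i; rewrite !mxE mulrA -exprD; congr (_ * _).
rewrite dffunM -[LHS]signr_odd -[RHS]signr_odd; congr (_ ^+ nat_of_bool _).
by case: (g i) (h i) => [[|[|//]] ?] [[|[|//]] ?].
Qed.

Definition rho (R : realType) (n : nat) (A : {set signs n}) : R :=
  #|A|%:R / #|[set: signs n]%SET|%:R.

(* | P(T(X) > t) - E_X rho({g : T(pi_g X) > t}) | *)
Definition discrepancy d (Omega : measurableType d) (R : realType)
    (P : probability Omega R) (n : nat) (X : 'I_n -> {RV P >-> R})
    (theta : 'rV[R]_n) (t : R) : \bar R :=
  (`| P [set w | (t < lin_stat theta (rvec X w))%R]
     - 'E_P[(fun w => rho R
         [set g : signs n |
            t < lin_stat theta (sign_act g (rvec X w))]%SET)%R] |)%E.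

Arguments discrepancy {d Omega R} P {n} X theta t.

Definition error_bound (R : realType) (C sigma omega : R) (n : nat)
    (theta : 'rV[R]_n) : R :=
  2 * C * omega / sigma ^+ 3 * \sum_(i < n) `|theta 0 i| ^+ 3.

(* Main.v *)
From HB Require Import structures.
Require Import Defs.
From mathcomp Require Import all_boot all_order all_algebra all_fingroup.
From mathcomp Require Import all_classical all_reals all_analysis.
From mathcomp Require Import measurable_realfun ring lra.
Import Order.TTheory GRing.Theory Num.Theory.
Import numFieldNormedType.Exports.
Local Open Scope classical_set_scope.
Local Open Scope ring_scope.

(** Both probabilities are close to the same Gaussian tail. For a fixed sign
    vector g, the statistic T(pi_g X) is again a weighted sum of the X_i, with
    weights g_i theta_i; these have the same squares and the same absolute
    cubes as the theta_i. A Berry-Esseen inequality for weighted sums therefore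
    compares P(T(X) > t) and each P(T(pi_g X) > t) with 1 - Phi(t / sigma), with
    one and the same error C omega / sigma^3 sum |theta_i|^3. Averaging over g
    and the triangle inequality give the factor 2 ([discrepancy_le]).

    The Berry-Esseen inequality ([berry_esseen]) is proved for sums W of
    independent centred, not identically distributed variables xi_i with
    variances s_i^2 adding up to 1, by Stein's method. Write beta for the sum of
    the E|xi_i|^3, and W_i for W - xi_i, which is independent of xi_i.

    The equation f'(w) - w f(w) = 1{w <= z} - Phi(z) has the explicit solution
    [stein z], so that P(W <= z) - Phi(z) = E f'(W) - E W f(W). Since xi_i is
    centred and independent of W_i, the right-hand side is the sum over i of
      s_i^2 E(f'(W) - f'(W_i)) - E xi_i (f(W) - f(W_i) - xi_i f'(W_i)).
    The function f' is Lipschitz with constant O(1 + |w|) apart from its jump at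
    z ([dstein_variation], [stein_expansion]). The Lipschitz part contributes
    O(E|xi_i|^3), and the jump matters only when W_i is within |xi_i| of z.

    That event is controlled by the concentration inequality
    P(a <= W_i <= b) <= (b - a) + 4 beta ([concentration]), which is obtained by
    testing W against a clipped linear function. Conditioning on xi_i
    ([EX_section_le]) turns it into a contribution O(E|xi_i|^3 + beta s_i^2),
    and the sum over i is O(beta). *)

Set Implicit Arguments.
Unset Strict Implicit.
Unset Printing Implicit Defensive.

(** * The normal distribution function and the Stein equation *)

Section Normal.
Context {R : realType}.
Local Notation mu := (@lebesgue_measure R).
Implicit Types w x y z : R.

Definition phi : R -> R := normal_pdf 0 1.
Definition Phi z : R := \int[mu]_(t in `]-oo, z]) phi t.

Lemma phiE x : phi x = normal_peak 1 * expR (- (x ^+ 2 / 2)).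
Proof.
by rewrite /phi normal_pdfE ?oner_neq0// /normal_fun subr0 expr1n mulNr.
Qed.

Lemma phi_gt0 x : 0 < phi x.
Proof. by rewrite phiE mulr_gt0 ?expR_gt0 ?normal_peak_gt0 ?oner_neq0. Qed.

Lemma phiN x : phi (- x) = phi x.
Proof. by rewrite !phiE sqrrN. Qed.

Lemma is_derive_phi x : is_derive x 1 phi (- x * phi x).
Proof.
have -> : phi = (fun x => normal_peak 1 * expR (- (x ^+ 2 / 2))).
  by apply/funext => y; rewrite phiE.
by apply: is_derive_eq; rewrite /GRing.scale/=; field.
Qed.

Lemma is_derive_Phi x : is_derive x 1 Phi (phi x).
Proof.
have [||||dF <-] := @continuous_FTC1 R phi -oo%O x (x + 1).
- by rewrite ltrDl.
- apply: integrableS (integrable_normal_pdf 0 1) => //.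
- by rewrite ltNyr.
- exact/continuous_normal_pdf/oner_neq0.
- by rewrite derive1E; exact/derivableP.
Qed.

Lemma PhiE x : (Phi x)%:E = normal_prob 0 1 `]-oo, x].
Proof.
by rewrite /Phi /Rintegral fineK//; exact: (@fin_num_measure _ _ _ (normal_prob 0 1)).
Qed.

(** The identity as a random variable on the line: its distribution function
    under the standard normal law is [Phi]. *)
Definition idT : measurableTypeR R -> R := idfun.
HB.instance Definition _ :=
  @isMeasurableFun.Build _ _ _ _ idT (@measurable_id _ _ setT).

Lemma cvg_Phiy : Phi x @[x --> +oo] --> (1 : R).
Proof.
have := @cvg_cdfy1 _ _ _ (normal_prob 0 1) idT.
move/fine_cvg; apply: cvg_trans; apply: near_eq_cvg; near=> x.
by rewrite /= -PhiE.
Unshelve. all: end_near. Qed.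

Lemma cvg_PhiNy : Phi x @[x --> -oo] --> (0 : R).
Proof.
have := @cvg_cdfNy0 _ _ _ (normal_prob 0 1) idT.
move/fine_cvg; apply: cvg_trans; apply: near_eq_cvg; near=> x.
by rewrite /= -PhiE.
Unshelve. all: end_near. Qed.

Lemma Phi_ge0 x : 0 <= Phi x.
Proof. by apply: Rintegral_ge0 => y _; exact/ltW/phi_gt0. Qed.

Lemma is_derive_continuous (F dF : R -> R) :
  (forall x, is_derive x 1 F (dF x)) -> continuous F.
Proof.
move=> dFd x; apply: differentiable_continuous.
by apply/derivable1_diffP; case: (dFd x).
Qed.

Lemma continuous_Phi : continuous Phi.
Proof. exact: is_derive_continuous is_derive_Phi. Qed.

Lemma continuous_phi : continuous phi.
Proof. exact/continuous_normal_pdf/oner_neq0. Qed.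

Lemma MVT_lt (F dF : R -> R) x y : x < y ->
  (forall t, x < t < y -> is_derive t 1 F (dF t)) -> continuous F ->
  exists2 t, x < t < y & F y - F x = dF t * (y - x).
Proof.
move=> xy dFd cF.
have dF' t : t \in `]x, y[ -> is_derive t 1 F (dF t) by rewrite in_itv/=; exact: dFd.
have [t] := MVT xy dF' (continuous_subspaceT cF).
by rewrite in_itv/= => ? ?; exists t.
Qed.

Lemma Phi_le1 x : Phi x <= 1.
Proof.
by rewrite -lee_fin PhiE; exact: (@probability_le1 _ _ _ (normal_prob 0 1)).
Qed.

Lemma le_Phi x y : x <= y -> Phi x <= Phi y.
Proof.
rewrite le_eqVlt => /predU1P[->//|xy].
have [t _ E] := MVT_lt xy (fun t _ => is_derive_Phi t) continuous_Phi.
by rewrite -subr_ge0 E mulr_ge0 ?(ltW (phi_gt0 _)) ?subr_ge0// ltW.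
Qed.

(** The Mills ratio bound, for any primitive H of the density with limit 1 at
    infinity, so that it applies to both tails. The function w * H + phi has
    derivative (w - y) phi(y) at y, hence decreases beyond w; compare its value
    at w with its limit w at infinity. *)
Lemma gaussian_tail (H : R -> R) :
  (forall x, is_derive x 1 H (phi x)) -> H x @[x --> +oo] --> (1 : R) ->
  forall w, 0 < w -> w * (1 - H w) <= phi w.
Proof.
move=> dH H1 w w0.
pose K := (fun y => w * H y + phi y).
have dK x : is_derive x 1 K ((w - x) * phi x).
  have dHx := dH x; have dpx := is_derive_phi x.
  by rewrite /K; apply: is_derive_eq; rewrite /GRing.scale/=; ring.
have cK := is_derive_continuous dK.
have KK y : w < y -> w * H y <= w * H w + phi w.
  move=> wy; have [t /andP[wt _] E] := MVT_lt wy (fun t _ => dK t) cK.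
  have : K y - K w <= 0.
    rewrite E mulr_le0_ge0 ?subr_ge0 ?(ltW wy)//.
    by rewrite mulr_le0_ge0 ?subr_le0 ?(ltW wt) ?(ltW (phi_gt0 _)).
  by rewrite subr_le0 /K; apply: le_trans; rewrite lerDl ltW// phi_gt0.
suff : w * 1 <= w * H w + phi w by rewrite mulrBr lerBlDl.
have : w * H x @[x --> +oo] --> w * 1 by apply: cvgMl_tmp.
move=> /cvgr_to_le; apply; near=> y; apply: KK; near: y.
by apply: nbhs_pinfty_gt; rewrite ?num_real.
Unshelve. all: end_near. Qed.

Lemma upper_gaussian_tail w : 0 < w -> w * (1 - Phi w) <= phi w.
Proof. exact: gaussian_tail is_derive_Phi cvg_Phiy w. Qed.

Lemma lower_gaussian_tail w : 0 < w -> w * Phi (- w) <= phi w.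
Proof.
rewrite -[Phi _](subKr 1); move: w.
apply: (@gaussian_tail (fun x => 1 - Phi (- x))) => [x|].
  have dPhi := is_derive_Phi (- x).
  have dc : is_derive x 1 (fun y => Phi (- y)) (phi (- x) * -1).
    exact: is_derive1_comp.
  by apply: is_derive_eq; rewrite phiN; ring.
rewrite -[X in _ --> X]subr0; apply: cvgB; first exact: cvg_cst.
by have := cvg_PhiNy; rewrite cvgNy_compNP.
Qed.

(** The bounded solution f of f'(w) - w f(w) = 1{w <= z} - Phi(z): it is
    Phi(w) (1 - Phi(z)) / phi(w) for w <= z and Phi(z) (1 - Phi(w)) / phi(w) for
    w >= z. *)
Definition stein z w : R := Phi (Num.min w z) * (1 - Phi (Num.max w z)) / phi w.
(** The derivative of [stein z] away from z, read off the Stein equation; this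
    formula also gives the value used at z. *)
Definition dstein z w : R := w * stein z w + (w <= z)%R%:R - Phi z.

Lemma stein_ge0 z w : 0 <= stein z w.
Proof.
by rewrite divr_ge0 ?mulr_ge0 ?Phi_ge0 ?subr_ge0 ?Phi_le1// ltW ?phi_gt0.
Qed.

Lemma stein_le_upper z w : stein z w <= (1 - Phi w) / phi w.
Proof.
rewrite ler_pM2r ?invr_gt0 ?phi_gt0// -[leRHS]mul1r ler_pM//.
- exact: Phi_ge0.
- by rewrite subr_ge0 Phi_le1.
- exact: Phi_le1.
- by rewrite lerD2l lerN2 le_Phi// le_max lexx.
Qed.

Lemma stein_le_lower z w : stein z w <= Phi w / phi w.
Proof.
rewrite ler_pM2r ?invr_gt0 ?phi_gt0// -[leRHS]mulr1 ler_pM//.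
- exact: Phi_ge0.
- by rewrite subr_ge0 Phi_le1.
- by rewrite le_Phi// ge_min lexx.
- by rewrite gerBl Phi_ge0.
Qed.

(** The solution lies below both (1 - Phi) / phi and Phi / phi; the tail bound
    makes the first at most 1/w for w > 0 and the second at most 1/|w| for
    w < 0. *)
Lemma norm_mul_stein z w : `|w * stein z w| <= 1.
Proof.
rewrite normrM (ger0_norm (stein_ge0 _ _)).
have p0 := phi_gt0 w.
have [w0|w0|->] := ltrgt0P w; last by rewrite mul0r ler01.
- apply: (le_trans (ler_wpM2l _ (stein_le_upper z w))); first exact: ltW.
  by rewrite mulrA ler_pdivrMr// mul1r upper_gaussian_tail.
- rewrite -oppr_gt0 in w0.
  apply: (le_trans (ler_wpM2l _ (stein_le_lower z w))); first exact: ltW.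
  rewrite mulrA ler_pdivrMr// mul1r -phiN -{2}(opprK w).
  exact: lower_gaussian_tail.
Qed.

Definition stein_const : R := 1 + (phi 1)^-1.

(** For |w| <= 1 the density is at least phi(1); for |w| > 1 the bound on
    w f(w) suffices. *)
Lemma stein_le z w : stein z w <= stein_const.
Proof.
have [w1|w1] := leP `|w| 1.
  have : stein z w <= (phi 1)^-1; last by rewrite /stein_const; lra.
  apply: (le_trans (stein_le_lower _ _)).
  rewrite -[leRHS]mul1r ler_pM ?Phi_ge0 ?Phi_le1 ?invr_ge0 ?(ltW (phi_gt0 _))//.
  rewrite lef_pV2 ?posrE ?phi_gt0// !phiE ler_pM2l ?normal_peak_gt0 ?oner_neq0//.
  rewrite ler_expR lerN2 ler_pM2r ?invr_gt0// -[w ^+ 2]real_normK ?num_real//.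
  by rewrite ler_pXn2r ?nnegrE.
have : stein z w <= 1; last first.
  by have := phi_gt0 1; rewrite -invr_gt0 /stein_const; lra.
have := norm_mul_stein z w; rewrite normrM (ger0_norm (stein_ge0 _ _)).
by have := stein_ge0 z w; nra.
Qed.

Lemma stein_const_ge0 : 0 <= stein_const.
Proof. exact: le_trans (stein_ge0 0 0) (stein_le 0 0). Qed.

Lemma norm_stein_le z w : `|stein z w| <= stein_const.
Proof. by rewrite (ger0_norm (stein_ge0 _ _)) stein_le. Qed.

Lemma norm_dstein_le z w : `|dstein z w| <= 2.
Proof.
have := norm_mul_stein z w; have := Phi_ge0 z; have := Phi_le1 z.
rewrite /dstein !ler_norml; by case: (w <= z); rewrite /=; lra.
Qed.

Lemma continuous_stein z : continuous (stein z).
Proof.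
move=> x; apply: cvgM; last first.
  by apply: cvgV; [rewrite gt_eqF ?phi_gt0|exact: continuous_phi].
apply: cvgM.
  apply: (continuous_comp (f := fun w => Num.min w z)); last exact: continuous_Phi.
  by apply: continuous_min; [exact: cvg_id|exact: cvg_cst].
apply: cvgB; first exact: cvg_cst.
apply: (continuous_comp (f := fun w => Num.max w z)); last exact: continuous_Phi.
by apply: continuous_max; [exact: cvg_id|exact: cvg_cst].
Qed.

Lemma is_derive_stein z w : w != z -> is_derive w 1 (stein z) (dstein z w).
Proof.
have p0 : phi w != 0 by rewrite gt_eqF ?phi_gt0.
have dP := is_derive_Phi w; have dp := is_derive_phi w.
have dV := is_deriveV p0 dp.
rewrite neq_lt => /orP[wz|zw].
- apply: (@near_eq_is_derive _ _ _ (fun w => Phi w * (1 - Phi z) * (phi w)^-1)).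
    near=> x; rewrite /stein; have xz : x < z by near: x; exact: lt_nbhsl.
    by rewrite min_l ?max_r// ltW.
  apply: is_derive_eq; rewrite /dstein/stein (ltW wz) min_l ?max_r ?(ltW wz)//.
  by rewrite /GRing.scale/=; field.
- apply: (@near_eq_is_derive _ _ _ (fun w => Phi z * (1 - Phi w) * (phi w)^-1)).
    near=> x; rewrite /stein; have xz : z < x by near: x; exact: lt_nbhsr.
    by rewrite min_r ?max_l// ltW.
  apply: is_derive_eq; rewrite /dstein/stein leNgt zw min_r ?max_l ?(ltW zw)//.
  by rewrite /GRing.scale/=; field.
Unshelve. all: end_near. Qed.

(** A mean value inequality that tolerates one point z without derivative: if z
    is inside the interval, add the inequalities on both sides of it. *)
Lemma mean_value_except (F dF : R -> R) z k B x y : continuous F ->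
  (forall t, t != z -> is_derive t 1 F (dF t)) -> x <= y ->
  (forall t, x < t < y -> `|dF t - k| <= B) ->
  `|F y - F x - k * (y - x)| <= B * (y - x).
Proof.
move=> cF dFd xy bF.
have step u v : u <= v -> x <= u -> v <= y -> (v <= z) || (z <= u) ->
    `|F v - F u - k * (v - u)| <= B * (v - u).
  rewrite le_eqVlt => /predU1P[->|uv] xu vy zuv.
    by rewrite !subrr !mulr0 subrr normr0.
  have [t|t /andP[ut tv] ->] := MVT_lt uv _ cF (dF := dF).
    move=> /andP[ut tv]; apply: dFd; case/orP: zuv => h.
    - by rewrite lt_eqF// (lt_le_trans tv).
    - by rewrite gt_eqF// (le_lt_trans h).
  have vu0 : 0 <= v - u by rewrite subr_ge0 ltW.
  rewrite -mulrBl normrM (ger0_norm vu0) ler_wpM2r// bF//.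
  by rewrite (le_lt_trans xu ut) (lt_le_trans tv vy).
have [zx|xz] := leP z x; first by apply: step => //; rewrite zx orbT.
have [yz|zy] := leP y z; first by apply: step => //; rewrite yz.
have h1 := step x z (ltW xz) (lexx _) (ltW zy) ltac:(by rewrite lexx).
have h2 := step z y (ltW zy) (ltW xz) (lexx _) ltac:(by rewrite lexx orbT).
have -> : F y - F x - k * (y - x) =
   (F z - F x - k * (z - x)) + (F y - F z - k * (y - z)) by ring.
by apply: (le_trans (ler_normD _ _)); rewrite (le_trans (lerD h1 h2))//; lra.
Qed.

Lemma mean_value_except_norm (F dF : R -> R) z k B w x : continuous F ->
  (forall t, t != z -> is_derive t 1 F (dF t)) ->
  (forall t, `|t - w| <= `|x| -> `|dF t - k| <= B) ->
  `|F (w + x) - F w - x * k| <= `|x| * B.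
Proof.
move=> cF dFd bF; have [x0|x0] := leP 0 x.
- have := @mean_value_except F dF z k B w (w + x) cF dFd.
  rewrite lerDl x0 => /(_ erefl); rewrite [w + x - w]addrC addKr.
  rewrite (ger0_norm x0) [x * k]mulrC [x * B]mulrC; apply => t /andP[wt tx].
  by apply: bF; rewrite (ger0_norm x0) ger0_norm; lra.
- have := @mean_value_except F dF z k B (w + x) w cF dFd.
  rewrite gerDl (ltW x0) => /(_ erefl).
  have -> : w - (w + x) = - x by ring.
  have -> : F (w + x) - F w - x * k = - (F w - F (w + x) - k * - x) by ring.
  rewrite (ltr0_norm x0) [- x * B]mulrC normrN; apply.
  move=> t /andP[wt tx].
  by apply: bF; rewrite (ltr0_norm x0) ler0_norm; lra.
Qed.

Lemma stein_lipschitz z w x : `|stein z (w + x) - stein z w| <= 2 * `|x|.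
Proof.
have := @mean_value_except_norm (stein z) (dstein z) z 0 2 w x
  (@continuous_stein z) (@is_derive_stein z).
rewrite mulr0 subr0 mulrC; apply => t _; rewrite subr0; exact: norm_dstein_le.
Qed.

Definition smooth_const : R := stein_const + 2.

Lemma smooth_const_ge0 : 0 <= smooth_const.
Proof. by rewrite addr_ge0 ?stein_const_ge0. Qed.

(** Write (w + x) f(w + x) - w f(w) as x f(w + x) + w (f(w + x) - f(w)), with f
    bounded and 2-Lipschitz. The indicator of w <= z can only change between w
    and w + x when z is within |x| of w. *)
Lemma dstein_variation z w x :
  `|dstein z (w + x) - dstein z w| <=
    smooth_const * (1 + `|w|) * `|x| + (`|w - z| <= `|x|)%R%:R.
Proof.
have -> : dstein z (w + x) - dstein z w = x * stein z (w + x) +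
   w * (stein z (w + x) - stein z w) + ((w + x <= z)%R%:R - (w <= z)%R%:R).
  by rewrite /dstein; ring.
apply: (le_trans (ler_normD _ _)); apply: lerD.
  apply: (le_trans (ler_normD _ _)); rewrite normrM [`|w * _|]normrM.
  have h1 : `|x| * `|stein z (w + x)| <= `|x| * stein_const.
    by rewrite ler_wpM2l ?norm_stein_le.
  have h2 : `|w| * `|stein z (w + x) - stein z w| <= `|w| * (2 * `|x|).
    by rewrite ler_wpM2l ?stein_lipschitz.
  apply: (le_trans (lerD h1 h2)).
  have : 0 <= stein_const * `|x| * `|w| by rewrite !mulr_ge0 ?stein_const_ge0.
  by rewrite /smooth_const; have := normr_ge0 x; lra.
have [|] := boolP (`|w - z| <= `|x|) => h.
  by case: (w + x <= z); case: (w <= z); 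
    rewrite /= ?subrr ?subr0 ?sub0r ?normrN ?normr0 ?normr1.
suff -> : (w + x <= z) = (w <= z) by rewrite subrr normr0.
move: h; rewrite -ltNge.
have := ler_norm x; have := ler_norm (- x); rewrite normrN.
by case: (ger0P (w - z)) => ? ? ? ?; apply/idP/idP; lra.
Qed.

(** The first-order Taylor remainder is governed by the variation of the
    derivative between w and w + x. *)
Lemma stein_expansion z w x :
  `|stein z (w + x) - stein z w - x * dstein z w| <=
    `|x| * (smooth_const * (1 + `|w|) * `|x| + (`|w - z| <= `|x|)%R%:R).
Proof.
apply: (@mean_value_except_norm _ (dstein z) z) => [||t twx].
- exact: continuous_stein.
- exact: is_derive_stein.
- have := dstein_variation z w (t - w).
  have -> : w + (t - w) = t by ring.
  move=> /le_trans; apply.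
  apply: lerD.
    by rewrite ler_wpM2l// mulr_ge0 ?smooth_const_ge0// addr_ge0.
  rewrite ler_nat; case: (leP `|w - z| `|t - w|) => // h.
  by rewrite (le_trans h twx).
Qed.

End Normal.

(** * Expectations and independence *)

Lemma measurable_bool_natr d (T : measurableType d) (R : realType)
    (b : T -> bool) : measurable_fun setT b ->
  measurable_fun setT (fun w => (b w)%:R : R).
Proof.
move=> mb; have -> : (fun w => (b w)%:R : R) = \1_[set w | b w].
  by apply/funext => w; rewrite indicE mem_setE.
apply: measurable_indic; rewrite -[X in measurable X]setTI.
exact: (mb measurableT [set true]).
Qed.

Section Independence.
Context d {T : measurableType d} {R : realType} (P : probability T R).
Implicit Types (U V u v : T -> R) (E : set T) (c : R).

Definition indep_pair U V := forall A B : set R, measurable A -> measurable B ->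
  P (U @^-1` A `&` V @^-1` B) = (P (U @^-1` A) * P (V @^-1` B))%E.

Definition mkmfun d1 (T' : measurableType d1) (f : T -> T')
    (mf : measurable_fun setT f) : {mfun T >-> T'} :=
  HB.pack f (isMeasurableFun.Build _ _ _ _ f mf).

(** Rectangles are stable under intersection and generate the product
    sigma-algebra. *)
Lemma measure_eq_on_rectangles
    (m1 m2 : {measure set (measurableTypeR R * measurableTypeR R) -> \bar R}) :
  (m1 setT < +oo)%E ->
  (forall A B : set (measurableTypeR R), measurable A -> measurable B ->
    m1 (A `*` B) = m2 (A `*` B)) ->
  forall C, measurable C -> m1 C = m2 C.
Proof.
move=> m1oo m12.
pose G := [set A `*` B | A in @measurable _ (measurableTypeR R) &
  B in @measurable _ (measurableTypeR R)].
apply: (measure_unique G (fun=> setT)) => //.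
- exact: measurable_prod_measurableType.
- move=> /= _ _ [X1 mX1 [X2 mX2 <-]] [Y1 mY1 [Y2 mY2 <-]].
  rewrite -setXI; exists (X1 `&` Y1); first exact: measurableI.
  by exists (X2 `&` Y2) => //; exact: measurableI.
- by move=> _; exists setT => //; exists setT => //; rewrite setXTT.
- by rewrite bigcup_const //; exists 0%N.
- by move=> _ [A mA [B mB <-]]; exact: m12.
Qed.

Lemma measurable_preim (U : T -> R) (A : set R) : measurable_fun setT U ->
  measurable A -> measurable (U @^-1` A).
Proof. by move=> mU mA; rewrite -[X in measurable X]setTI; exact: mU. Qed.

(** If the pair (U, V) is independent of E on rectangles, it is so on every
    measurable subset of the plane, in particular on half-planes and other sets
    defined by U + V. *)
Lemma indep_sum_event U V E B :
  measurable_fun setT U -> measurable_fun setT V ->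
  measurable E ->
  (forall A B : set R, measurable A -> measurable B ->
    P (U @^-1` A `&` V @^-1` B `&` E) = (P (U @^-1` A `&` V @^-1` B) * P E)%E) ->
  measurable B ->
  P ((U \+ V) @^-1` B `&` E) = (P ((U \+ V)%R @^-1` B)%classic * P E)%E.
Proof.
move=> mU mV mE H mB.
pose UV : T -> measurableTypeR R * measurableTypeR R := fun w => (U w, V w).
have mUV : measurable_fun setT UV by exact: measurable_fun_pair.
pose law (m : {measure set T -> \bar R}) : {measure set _ -> \bar R} :=
  measure_function_pushforward__canonical__measure_function_Measure m mUV.
have PE0 : 0 <= fine (P E) by rewrite fine_ge0.
(* the law of (U, V) on the event E, against its unrestricted law times P E *)
pose m1 := law (mrestr P mE).
pose m2 : {measure set _ -> \bar R} := mscale (NngNum PE0) (law P).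
pose add (z : measurableTypeR R * measurableTypeR R) := z.1 + z.2.
have madd : measurable_fun setT add by exact: measurable_funD.
have mS : measurable (add @^-1` B).
  by rewrite -[X in measurable X]setTI; exact: madd.
have := @measure_eq_on_rectangles m1 m2 _ _ _ mS.
rewrite /m1 /m2 /law /= /pushforward /mrestr /mscale /= fineK ?fin_num_measure//.
rewrite [RHS]muleC.
apply.
- by rewrite (le_lt_trans (probability_le1 _ _)) ?ltry// preimage_setT setTI.
- by move=> A C mA mC; rewrite muleC -H.
Qed.

Definition L1 (u : T -> R) := P.-integrable setT (EFin \o u).

Lemma L1_measurable u : L1 u -> measurable_fun setT u.
Proof. by move=> /integrableP[/measurable_EFinP]. Qed.

Lemma L1_le u v : measurable_fun setT u -> L1 v ->
  (forall w, `|u w| <= v w) -> L1 u.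
Proof.
move=> mu lv uv; apply: le_integrable lv => //; first exact/measurable_EFinP.
by move=> w _ /=; rewrite lee_fin (le_trans (uv w))// ler_norm.
Qed.

Lemma L1_cst c : L1 (fun=> c).
Proof. exact: finite_measure_integrable_cst. Qed.

Lemma L1_bounded u c : measurable_fun setT u ->
  (forall w, `|u w| <= c) -> L1 u.
Proof. by move=> mu; apply: L1_le => //; exact: L1_cst. Qed.

Lemma L1_bool (b : T -> bool) : measurable_fun setT b ->
  L1 (fun w => (b w)%:R).
Proof.
move=> mb; apply: (@L1_bounded _ 1); first exact: measurable_bool_natr.
by move=> w; case: (b w); rewrite ?normr1 ?normr0.
Qed.

Lemma L1D u v : L1 u -> L1 v -> L1 (fun w => u w + v w).
Proof. by move=> lu lv; apply: eq_integrable (integrableD _ lu lv). Qed.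

Lemma L1Z c u : L1 u -> L1 (fun w => c * u w).
Proof. by move=> lu; apply: eq_integrable (integrableZl _ c lu). Qed.

Lemma L1N u : L1 u -> L1 (fun w => - u w).
Proof. by move=> /(L1Z (-1)); congr L1; apply/funext => w; rewrite mulN1r. Qed.

Lemma L1B u v : L1 u -> L1 v -> L1 (fun w => u w - v w).
Proof. by move=> lu /L1N; exact: L1D. Qed.

Lemma L1_norm u : L1 u -> L1 (fun w => `|u w|).
Proof. by move=> lu; apply: eq_integrable (integrable_abse lu). Qed.

Lemma L1_sum (I : Type) (s : seq I) (p : pred I) (u : I -> T -> R) :
  (forall i, p i -> L1 (u i)) -> L1 (fun w => \sum_(i <- s | p i) u i w).
Proof.
move=> lu; elim: s => [|i s IH].
  have -> : (fun w => \sum_(i <- [::] | p i) u i w) = cst 0.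
    by apply/funext => w; rewrite big_nil.
  exact: L1_cst.
have -> : (fun w => \sum_(j <- i :: s | p j) u j w) =
    (fun w => (if p i then u i w else 0) + \sum_(j <- s | p j) u j w).
  by apply/funext => w; rewrite big_cons; case: ifP => //; rewrite add0r.
by apply: L1D => //; case: (p i) (lu i) => [->//|_]; exact: L1_cst.
Qed.

Lemma EXD u v : L1 u -> L1 v ->
  \int[P]_w (u w + v w) = \int[P]_w u w + \int[P]_w v w.
Proof. exact: RintegralD. Qed.

Lemma EXB u v : L1 u -> L1 v ->
  \int[P]_w (u w - v w) = \int[P]_w u w - \int[P]_w v w.
Proof. exact: RintegralB. Qed.

Lemma EXZ c u : L1 u -> \int[P]_w (c * u w) = c * \int[P]_w u w.
Proof. exact: RintegralZl. Qed.

Lemma EX_cst c : \int[P]_w (c : R) = c.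
Proof.
by rewrite Rintegral_cst//; have /= -> := probability_setT P; rewrite mulr1.
Qed.

Lemma EX_sum (I : Type) (s : seq I) (p : pred I) (u : I -> T -> R) :
  (forall i, p i -> L1 (u i)) ->
  \int[P]_w (\sum_(i <- s | p i) u i w) = \sum_(i <- s | p i) \int[P]_w u i w.
Proof.
move=> lu; elim: s => [|i s IH].
  by under eq_Rintegral do rewrite big_nil; rewrite EX_cst big_nil.
under eq_Rintegral do rewrite big_cons; rewrite big_cons.
case: (p i) (lu i) => // /(_ erefl) lui.
by rewrite EXD ?IH//; exact: L1_sum.
Qed.

Lemma EX_le u v : L1 u -> L1 v -> (forall w, u w <= v w) ->
  \int[P]_w u w <= \int[P]_w v w.
Proof. by move=> lu lv uv; apply: le_Rintegral. Qed.

Lemma EX_ge0 u : (forall w, 0 <= u w) -> 0 <= \int[P]_w u w.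
Proof. by move=> u0; apply: Rintegral_ge0. Qed.

Lemma EX_norm u : L1 u -> `|\int[P]_w u w| <= \int[P]_w `|u w|.
Proof. by move=> lu; apply: le_normr_Rintegral. Qed.

Lemma EX_fin u : L1 u -> (\int[P]_w u w)%:E = (\int[P]_w (u w)%:E)%E.
Proof. by move=> lu; rewrite /Rintegral fineK//; exact: integrable_fin_num. Qed.

Lemma EX_indicator (b : T -> bool) : measurable [set w | b w] ->
  \int[P]_w (b w)%:R = fine (P [set w | b w]).
Proof.
move=> mb; rewrite /Rintegral -[in RHS](setIT [set w | b w]) -integral_indic//.
by congr fine; apply: eq_integral => w _; rewrite indicE mem_setE.
Qed.

Lemma integrable_law V (mV : measurable_fun setT V) : L1 V ->
  (distribution P (mkmfun mV)).-integrable setT (EFin : R -> \bar R).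
Proof. by move=> lV; exact: integrable_pushforward. Qed.

Lemma integral_law V (mV : measurable_fun setT V) : L1 V ->
  (\int[distribution P (mkmfun mV)]_x x%:E = (\int[P]_w V w)%R%:E)%E.
Proof. by move=> lV; rewrite EX_fin// integral_distribution. Qed.

Section Joint.
Variables U V : T -> R.
Hypotheses (mU : measurable_fun setT U) (mV : measurable_fun setT V).
Hypothesis UV : indep_pair U V.

Let lawU : probability _ R := distribution P (mkmfun mU).
Let lawV : probability _ R := distribution P (mkmfun mV).
Let pairUV : T -> R * R := fun w => (U w, V w).
Let mpair : measurable_fun setT pairUV. Proof. exact: measurable_fun_pair. Qed.
Let joint : probability _ R := distribution P (mkmfun mpair).

Lemma joint_law C : measurable C -> joint C = (lawU \x lawV)%E C.
Proof. by move=> mC; apply/esym; exact: product_measure_unique. Qed.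

Lemma ge0_integral_indep (h : R * R -> \bar R) :
  measurable_fun setT h -> (forall z, (0 <= h z)%E) ->
  (\int[P]_w h (U w, V w) = \int[P]_w \int[P]_w' h (U w, V w'))%E.
Proof.
move=> mh h0.
have -> : (\int[P]_w h (U w, V w) = \int[joint]_z h z)%E.
  by rewrite ge0_integral_distribution.
rewrite (eq_measure_integral (lawU \x lawV)%E); last first.
  by move=> A mA _; exact: joint_law.
rewrite fubini_tonelli1// ge0_integral_distribution//; last 2 first.
- exact: measurable_fun_fubini_tonelli_F.
- by move=> y; exact: integral_ge0.
apply: eq_integral => w _ /=; rewrite /fubini_F ge0_integral_distribution//.
exact: measurableT_comp.
Qed.

Lemma L1M_indep : L1 U -> L1 V -> L1 (fun w => U w * V w).
Proof.
move=> lU lV; apply/integrableP; split.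
  by apply/measurable_EFinP; exact: measurable_funM.
pose h := fun z : R * R => (`|z.1 * z.2|%R)%:E.
have mh : measurable_fun setT h.
  by apply/measurable_EFinP; apply: measurableT_comp => //; exact: measurable_funM.
have := ge0_integral_indep mh (fun z => normr_ge0 (z.1 * z.2)).
rewrite /h /= => ->.
have -> : (\int[P]_w \int[P]_w' (`|U w * V w'|)%:E =
    \int[P]_w ((\int[P]_w' `|V w'|)%R%:E * (`|U w|)%:E))%E.
  apply: eq_integral => w _.
  under eq_integral do rewrite normrM EFinM.
  by rewrite integralZl ?EX_fin 1?muleC//; exact: L1_norm.
rewrite integralZl//; last exact: L1_norm.
by rewrite -EX_fin ?ltry//; exact: L1_norm.
Qed.

Lemma EXM_indep : L1 U -> L1 V ->
  \int[P]_w (U w * V w) = \int[P]_w U w * \int[P]_w V w.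
Proof.
move=> lU lV.
pose h := fun z : R * R => (z.1 * z.2)%:E.
have mh : measurable_fun setT h by apply/measurable_EFinP; exact: measurable_funM.
have ih : joint.-integrable setT h.
  apply: (@integrable_pushforward _ _ _ _ _ pairUV mpair) => //; exact: L1M_indep.
have ih' : ((lawU \x lawV)%E).-integrable setT h.
  apply/integrableP; split => //.
  rewrite (eq_measure_integral joint); last first.
    by move=> A mA _; apply/esym; exact: joint_law.
  by case/integrableP: ih.
rewrite /Rintegral.
have -> : (\int[P]_w (U w * V w)%:E = \int[joint]_z h z)%E.
  by rewrite (@integral_distribution _ _ _ _ _ P (mkmfun mpair) h)//; exact: L1M_indep.
rewrite (eq_measure_integral (lawU \x lawV)%E); last first.
  by move=> A mA _; exact: joint_law.
rewrite -integral12_prod_meas1//.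
rewrite (eq_integral (fun x => (\int[P]_w V w)%R%:E * x%:E)%E); last first.
  move=> x _; rewrite /fubini_F /h /=.
  under eq_integral do rewrite EFinM.
  rewrite integralZl//; last exact: integrable_law.
  by rewrite integral_law// muleC.
rewrite integralZl//; last exact: integrable_law.
by rewrite integral_law//= mulrC.
Qed.

Lemma measurable_integral_section (h : R * R -> \bar R) :
  measurable_fun setT h -> (forall z, (0 <= h z)%E) ->
  measurable_fun setT (fun w => (\int[P]_w' h (U w, V w'))%E).
Proof.
move=> mh h0.
have := measurableT_comp (measurable_fun_fubini_tonelli_F (m2 := lawV) h mh h0) mU.
apply: eq_measurable_fun => w _ /=; rewrite /fubini_F.
by rewrite ge0_integral_distribution//; exact: measurableT_comp.
Qed.

(** Conditioning on U: if for each frozen value x the event b x (V) has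
    probability at most q x, then q (U) can replace the event b U V under the
    expectation. *)
Lemma EX_section_le (a : R -> R) (b : R -> R -> bool) (q : R -> R) :
  measurable_fun setT a -> measurable_fun setT (fun z : R * R => b z.1 z.2) ->
  (forall x, 0 <= a x) ->
  (forall x, fine (P [set w | b x (V w)]) <= q x) ->
  L1 (fun w => a (U w)) -> L1 (fun w => a (U w) * q (U w)) ->
  \int[P]_w (a (U w) * (b (U w) (V w))%:R) <= \int[P]_w (a (U w) * q (U w)).
Proof.
move=> ma mb a0 bq la laq.
pose h := fun z : R * R => (a z.1 * (b z.1 z.2)%:R)%:E.
have mb' := @measurable_bool_natr _ _ R _ mb.
have mh : measurable_fun setT h.
  apply/measurable_EFinP; apply: measurable_funM => //.
  exact: (measurableT_comp ma).
have h0 z : (0 <= h z)%E by rewrite lee_fin mulr_ge0.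
have := ge0_integral_indep mh h0; rewrite /h /= => E.
rewrite -lee_fin EX_fin ?E ?EX_fin//; last first.
  apply: L1_le la _.
    have := measurableT_comp mh mpair; move/measurable_EFinP; apply.
  move=> w; rewrite normrM (ger0_norm (a0 _)) -[leRHS]mulr1 ler_wpM2l//.
  by case: (b _ _); rewrite ?normr1 ?normr0.
have mbV x : measurable_fun setT (fun w => b x (V w)).
  exact: (measurableT_comp mb (measurable_fun_pair (measurable_cst x) mV)).
have mbx x : measurable [set w | b x (V w)].
  by have := mbV x measurableT [set true]; rewrite setTI; apply.
have lb x : L1 (fun w => (b x (V w))%:R) by exact: L1_bool.
have F w : (\int[P]_w' (a (U w) * (b (U w) (V w'))%:R)%:E =
   (a (U w) * fine (P [set w' | b (U w) (V w')]))%:E)%E.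
  under eq_integral do rewrite EFinM.
  by rewrite integralZl//; [rewrite EFinM -EX_indicator// EX_fin|exact: lb].
apply: ge0_le_integral => //.
- by move=> w _; apply: integral_ge0 => w' _; exact: (h0 (U w, V w')).
- exact: (measurable_integral_section mh h0).
- by apply/measurable_EFinP; exact: L1_measurable.
- by move=> w _; rewrite F lee_fin ler_wpM2l.
Qed.

End Joint.

Section Family.
Variables (n : nat) (xi : 'I_n -> T -> R).
Hypothesis mxi : forall i, measurable_fun setT (xi i).

Definition indep_family :=
  forall (J : {set 'I_n}) (A : 'I_n -> set R), (forall i, measurable (A i)) ->
    P (\bigcap_(i in [set` J]) (xi i @^-1` A i)) =
      (\prod_(i in J) P (xi i @^-1` A i))%E.

Hypothesis ixi : indep_family.

Definition subsum (S : {set 'I_n}) w := \sum_(i in S) xi i w.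

Lemma measurable_subsum S : measurable_fun setT (subsum S).
Proof.
have -> : subsum S = fun w => \sum_(i <- enum S) xi i w.
  by apply/funext => w; rewrite /subsum big_enum.
exact: measurable_sum.
Qed.

Lemma measurable_cylinder (J : {set 'I_n}) (A : 'I_n -> set R) :
  (forall i, measurable (A i)) ->
  measurable (\bigcap_(i in [set` J]) (xi i @^-1` A i)).
Proof.
move=> mA; apply: fin_bigcap_measurable; first exact: finite_finset.
by move=> i _; exact: measurable_preim.
Qed.

(** A sum of some of the variables is independent of any event on the others.
    Induction on the number of terms: moving the term j out of the sum and into
    the event, the induction hypothesis and the product rule show that the pair
    (remaining sum, xi_j) is independent of the event on rectangles, which is
    what [indep_sum_event] requires. *)
Lemma subsum_indep_cylinder (S J : {set 'I_n}) (A : 'I_n -> set R) (B : set R) :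
  (forall i, measurable (A i)) -> measurable B -> [disjoint S & J]%B ->
  P (subsum S @^-1` B `&` \bigcap_(i in [set` J]) (xi i @^-1` A i)) =
  (P (subsum S @^-1` B) * P (\bigcap_(i in [set` J]) (xi i @^-1` A i)))%E.
Proof.
move: {2}#|S| (erefl #|S|) => k; elim: k => [|k IH] in S J A B * => cS mA mB SJ.
  have -> : subsum S = cst 0.
    apply/funext => w; rewrite /subsum big1// => i.
    by move/eqP: cS; rewrite cards_eq0 => /eqP ->; rewrite inE.
  rewrite preimage_cst; case: ifPn => _; last by rewrite set0I measure0 mul0e.
  by rewrite setTI (probability_setT P) mul1e.
have /card_gt0P[j jS] : (0 < #|S|)%N by rewrite cS.
have jJ : j \notin J.
  by apply/negP => jJ; move/pred0P: SJ => /(_ j) /=; rewrite jS jJ.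
pose S' := (S :\ j)%SET.
have cS' : #|S'| = k by move: cS; rewrite (cardsD1 j) jS => -[].
have pS : subsum S = subsum S' \+ xi j.
  by apply/funext => w; rewrite /subsum (big_setD1 j jS) /= addrC.
rewrite pS; apply: indep_sum_event => //.
- exact: measurable_subsum.
- exact: measurable_cylinder.
move=> A' B' mA' mB'.
have cyl1 (J' : {set 'I_n}) : j \notin J' ->
    xi j @^-1` B' `&` \bigcap_(i in [set` J']) (xi i @^-1` A i) =
    \bigcap_(i in [set` (j |: J')%SET]) (xi i @^-1` (if i == j then B' else A i)).
  move=> jJ'; apply/seteqP; split => w /=.
    move=> [Bj H] i /=; rewrite !inE => /predU1P[->|iJ]; first by rewrite eqxx.
    by case: eqP => [->//|_]; exact: H.
  move=> H; split; first by have := H j; rewrite /= !inE eqxx; apply.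
  move=> i /= iJ; have := H i; rewrite /= !inE iJ orbT => /(_ isT).
  by case: eqP => // ij; move: jJ'; rewrite -ij iJ.
have mA2 i : measurable (if i == j then B' else A i) by case: eqP.
have D1 (J' : {set 'I_n}) : j \notin J' ->
    [disjoint S & J']%B -> [disjoint S' & (j |: J')%SET]%B.
  move=> jJ' /pred0P SJ'; apply/pred0P => i /=; have := SJ' i; rewrite /= !inE.
  by case: eqP => // _; case: (i \in S).
have one (J' : {set 'I_n}) : j \notin J' ->
    P (xi j @^-1` B' `&` \bigcap_(i in [set` J']) (xi i @^-1` A i)) =
    (P (xi j @^-1` B') * P (\bigcap_(i in [set` J']) (xi i @^-1` A i)))%E.
  move=> jJ'; rewrite cyl1// !ixi// big_setU1//= eqxx; congr (_ * _)%E.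
  by apply: eq_bigr => i iJ'; case: eqP => // ij; rewrite -ij iJ' in jJ'.
have Bj : xi j @^-1` B' =
    \bigcap_(i in [set` [set j]%SET]) (xi i @^-1` (if i == j then B' else A i)).
  rewrite -[[set j]%SET]finset.setU0 -cyl1 ?inE//.
  rewrite (_ : [set` finset.set0] = set0) ?bigcap_set0 ?setIT//.
  by apply/seteqP; split=> x //=; rewrite inE.
rewrite -setIA cyl1// IH//; last exact: D1.
rewrite -cyl1// one// [in RHS]Bj IH//; last first.
  rewrite -[[set j]%SET]finset.setU0 D1 ?inE//.
  by apply/pred0P => i /=; rewrite inE andbF.
by rewrite -Bj muleA.
Qed.

Lemma subsum_indep (S : {set 'I_n}) j : j \notin S -> indep_pair (xi j) (subsum S).
Proof.
move=> jS A B mA mB.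
have := @subsum_indep_cylinder S [set j]%SET (fun=> A) B (fun=> mA) mB.
have -> : \bigcap_(i in [set` [set j]%SET]) (xi i @^-1` A) = xi j @^-1` A.
  apply/seteqP; split => w /=; first by apply; rewrite /= inE.
  by move=> Aw i /=; rewrite inE => /eqP ->.
rewrite setIC muleC; apply.
apply/pred0P => i /=; rewrite inE.
by case: eqP => [->|]; rewrite ?andbF// (negbTE jS).
Qed.

Lemma subsum_set1 j : subsum [set j]%SET = xi j.
Proof. by apply/funext => w; rewrite /subsum big_set1. Qed.

Lemma pairwise_indep i j : i != j -> indep_pair (xi i) (xi j).
Proof. by move=> ij; rewrite -(subsum_set1 j); apply: subsum_indep; rewrite inE. Qed.

End Family.

Lemma indep_pair_comp U V (f g : R -> R) :
  measurable_fun setT f -> measurable_fun setT g -> indep_pair U V ->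
  indep_pair (f \o U) (g \o V).
Proof.
move=> mf mg UV A B mA mB; apply: (UV (f @^-1` A) (g @^-1` B)).
- by rewrite -[X in measurable X]setTI; exact: mf.
- by rewrite -[X in measurable X]setTI; exact: mg.
Qed.

End Independence.

(** * The test function of the concentration inequality *)

Section Clip.
Context {R : realType}.
Implicit Types x y w l m a b delta : R.

Definition clip l x : R := Num.max (- l) (Num.min l x).

Lemma norm_clip_le l x : 0 <= l -> `|clip l x| <= l.
Proof.
move=> l0; rewrite /clip ler_norml; apply/andP; split.
  by rewrite le_max lexx.
by rewrite ge_max ge_min lexx /= andbT; lra.
Qed.

Lemma le_clip l x y : x <= y -> clip l x <= clip l y.
Proof.
by move=> xy; rewrite /clip ge_max !le_max lexx /= le_min !ge_min lexx xy !orbT.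
Qed.

Lemma clip_id l x : - l <= x <= l -> clip l x = x.
Proof. by move=> /andP[lx xl]; rewrite /clip min_r// max_r. Qed.

Lemma continuous_clip l : continuous (clip l).
Proof.
move=> x; apply: (@continuous_max _ _ (cst (- l)) (fun y => Num.min l y)).
  exact: cvg_cst.
by apply: (@continuous_min _ _ (cst l) id); [exact: cvg_cst|exact: cvg_id].
Qed.

(** The clipped function has slope 1 on the interval [a, b] enlarged by delta on
    both sides, so starting from w in [a, b] a step x changes it by at least
    min(delta, |x|), in the direction of x. Outside [a, b] monotonicity alone
    makes the right-hand side nonnegative. *)
Lemma clip_increment a b delta w x : a <= b -> 0 < delta ->
  (a <= w <= b)%R%:R * (`|x| * Num.min delta `|x|) <=
  x * (clip ((b - a) / 2 + delta) (w - (a + b) / 2) -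
       clip ((b - a) / 2 + delta) (w - x - (a + b) / 2)).
Proof.
move=> ab d0; set l := _ + delta; set m := _ / 2.
have mono : 0 <= x * (clip l (w - m) - clip l (w - x - m)).
  have [x0|x0] := leP 0 x.
    by rewrite mulr_ge0// subr_ge0 le_clip//; lra.
  by rewrite mulr_le0// ?(ltW x0)// subr_le0 le_clip//; lra.
have [/andP[aw wb]|_] := boolP (a <= w <= b); last by rewrite mul0r.
rewrite mul1r.
have Ew : clip l (w - m) = w - m by apply: clip_id; rewrite /l /m; lra.
set t := Num.min delta `|x|.
have t0 : 0 <= t by rewrite le_min (ltW d0) /=.
have td : t <= delta by rewrite ge_min lexx.
have tx : t <= `|x| by rewrite ge_min lexx orbT.
have [x0|x0] := leP 0 x.
- rewrite (ger0_norm x0) in tx *; rewrite ler_wpM2l// Ew.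
  have : clip l (w - x - m) <= clip l (w - t - m) by rewrite le_clip//; lra.
  by rewrite [X in _ <= X -> _]clip_id; rewrite /l /m; lra.
- rewrite (ltr0_norm x0) in tx *; rewrite mulNr -mulrN ler_wnM2l// ?(ltW x0)// Ew.
  have : clip l (w + t - m) <= clip l (w - x - m) by rewrite le_clip//; lra.
  by rewrite [X in X <= _ -> _]clip_id; rewrite /l /m; lra.
Qed.

(** From x - x^2 / (4 delta) <= delta, a perfect square. *)
Lemma mul_min_ge delta x : 0 < delta -> 0 <= x ->
  x ^+ 2 - x ^+ 3 / (4 * delta) <= x * Num.min delta x.
Proof.
move=> d0 x0.
have -> : x ^+ 2 - x ^+ 3 / (4 * delta) = x * (x - x ^+ 2 / (4 * delta)).
  by field; lra.
rewrite ler_wpM2l// le_min; apply/andP; split; last first.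
  by rewrite gerBl divr_ge0 ?sqr_ge0//; lra.
rewrite -subr_ge0.
have -> : delta - (x - x ^+ 2 / (4 * delta)) =
    (x - 2 * delta) ^+ 2 / (4 * delta) by field; lra.
by rewrite divr_ge0 ?sqr_ge0//; lra.
Qed.

End Clip.

(** * Concentration and the Berry-Esseen inequality *)

Section BerryEsseen.
Context d {T : measurableType d} {R : realType} (P : probability T R).
Implicit Types (U V u v : T -> R) (c : R).

Lemma L1M_bounded u v c : L1 P u -> measurable_fun setT v ->
  (forall w, `|v w| <= c) -> L1 P (fun w => u w * v w).
Proof.
move=> lu mv vc; apply: (L1_le _ (L1Z c (L1_norm lu))).
  by apply: measurable_funM => //; exact: L1_measurable lu.
by move=> w; rewrite normrM mulrC ler_wpM2r.
Qed.

Lemma EX_sqr_sum n (S : {set 'I_n}) (Z : 'I_n -> T -> R) :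
  (forall i, L1 P (Z i)) -> (forall i, L1 P (fun w => Z i w ^+ 2)) ->
  (forall i, \int[P]_w Z i w = 0) ->
  (forall i j, i != j -> indep_pair P (Z i) (Z j)) ->
  L1 P (fun w => (\sum_(i in S) Z i w) ^+ 2) /\
  \int[P]_w (\sum_(i in S) Z i w) ^+ 2 = \sum_(i in S) \int[P]_w Z i w ^+ 2.
Proof.
move=> lZ lZ2 Z0 iZ.
have lZZ i j : L1 P (fun w => Z i w * Z j w).
  have [->|ij] := eqVneq i j; first exact: lZ2.
  by apply: L1M_indep; [exact: L1_measurable|exact: L1_measurable|exact: iZ|..].
have E : (fun w => (\sum_(i in S) Z i w) ^+ 2) =
    (fun w => \sum_(i in S) \sum_(j in S) Z i w * Z j w).
  by apply/funext => w; rewrite expr2 big_distrlr.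
rewrite E; split.
  by apply: L1_sum => i _; apply: L1_sum.
rewrite EX_sum; last by move=> i _; apply: L1_sum.
apply: eq_bigr => i iS; rewrite EX_sum//.
rewrite (bigD1 i)//= [X in _ + X]big1 ?addr0// => j /andP[_ ji].
rewrite EXM_indep// ?Z0 ?mul0r//; [exact: L1_measurable|exact: L1_measurable|].
by apply: iZ; rewrite eq_sym.
Qed.

Variables (n : nat) (xi : 'I_n -> T -> R) (s b : 'I_n -> R).
Hypothesis mxi : forall i, measurable_fun setT (xi i).
Hypothesis ixi : indep_family P xi.
Hypothesis lxi3 : forall i, L1 P (fun w => `|xi i w| ^+ 3).
Hypothesis xi_mean : forall i, \int[P]_w xi i w = 0.
Hypothesis xi_var : forall i, \int[P]_w xi i w ^+ 2 = s i ^+ 2.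
Hypothesis xi_third : forall i, \int[P]_w `|xi i w| ^+ 3 = b i.
Hypothesis s_ge0 : forall i, 0 <= s i.
Local Notation W := (subsum xi).
Implicit Types (S : {set 'I_n}) (i j : 'I_n) (w : T).

Lemma L1_xi i : L1 P (xi i).
Proof.
apply: (L1_le (mxi i) (L1D (L1_cst P 1) (lxi3 i))) => w.
have := normr_ge0 (xi i w); move: `|_| => x x0.
have : 0 <= (x - 1) ^+ 2 * (x + 2) by rewrite mulr_ge0 ?sqr_ge0//; lra.
have -> : (x - 1) ^+ 2 * (x + 2) = x ^+ 3 - 3 * x + 2 by ring.
by have := exprn_ge0 3 x0; lra.
Qed.

Lemma L1_xi2 i : L1 P (fun w => xi i w ^+ 2).
Proof.
apply: (L1_le _ (L1D (L1_cst P 1) (lxi3 i))) => [|w].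
  exact: measurable_funX.
rewrite normrX; have := normr_ge0 (xi i w); move: `|_| => x x0.
have : 0 <= (x - 1) ^+ 2 * (2 * x + 1) by rewrite mulr_ge0 ?sqr_ge0//; lra.
have -> : (x - 1) ^+ 2 * (2 * x + 1) = 2 * x ^+ 3 - 3 * x ^+ 2 + 1 by ring.
by have := exprn_ge0 3 x0; lra.
Qed.

Lemma b_ge0 i : 0 <= b i.
Proof. by rewrite -xi_third; apply: EX_ge0 => w; rewrite exprn_ge0. Qed.

(** Integrate 3 s x^2 <= 2 |x|^3 + s^3, which is
    (|x| - s)^2 (2 |x| + s) >= 0. *)
Lemma lyapunov i : s i ^+ 3 <= b i.
Proof.
have : \int[P]_w (3 * s i * xi i w ^+ 2 - s i ^+ 3) <= \int[P]_w (2 * `|xi i w| ^+ 3).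
  apply: EX_le.
  - by apply: L1B; [apply: L1Z; exact: L1_xi2|exact: L1_cst].
  - exact: L1Z.
  move=> w; rewrite -[xi i w ^+ 2]real_normK ?num_real//.
  have := normr_ge0 (xi i w); move: `|_| => x x0.
  rewrite -subr_ge0.
  have -> : 2 * x ^+ 3 - (3 * s i * x ^+ 2 - s i ^+ 3) =
    (x - s i) ^+ 2 * (2 * x + s i) by ring.
  by rewrite mulr_ge0 ?sqr_ge0// addr_ge0 ?s_ge0// mulr_ge0.
rewrite EXB; [|by apply: L1Z; exact: L1_xi2|exact: L1_cst].
rewrite EXZ; last exact: L1_xi2.
rewrite EX_cst EXZ// xi_var xi_third.
have -> : 3 * s i * s i ^+ 2 = 3 * s i ^+ 3 by ring.
lra.
Qed.

(** Integrating 2 s |x| <= x^2 + s^2 gives s_i E|xi_i| <= s_i^2, so the left-hand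
    side is at most s_i^3. *)
Lemma sqr_mean_le i : s i ^+ 2 * \int[P]_w `|xi i w| <= b i.
Proof.
apply: le_trans (lyapunov i).
have : \int[P]_w (2 * s i * `|xi i w|) <= \int[P]_w (xi i w ^+ 2 + s i ^+ 2).
  apply: EX_le.
  - exact/L1Z/L1_norm/L1_xi.
  - by apply: L1D; [exact: L1_xi2|exact: L1_cst].
  move=> w; rewrite -[xi i w ^+ 2]real_normK ?num_real//; move: `|_| => x.
  by have := sqr_ge0 (x - s i); rewrite sqrrB; lra.
rewrite EXZ; last exact/L1_norm/L1_xi.
rewrite EXD; [|exact: L1_xi2|exact: L1_cst].
rewrite EX_cst xi_var => h.
have {}h : s i * \int[P]_w `|xi i w| <= s i ^+ 2 by lra.
by rewrite expr2 -mulrA exprS ler_wpM2l.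
Qed.

Lemma subsumD1 S i w : i \in S -> W S w = W (S :\ i)%SET w + xi i w.
Proof. by move=> iS; rewrite /subsum (big_setD1 i iS) /= addrC. Qed.

Lemma L1_subsum S : L1 P (W S).
Proof. by apply: L1_sum => i _; exact: L1_xi. Qed.

Lemma EX_subsum2 S : L1 P (fun w => W S w ^+ 2) /\
  \int[P]_w W S w ^+ 2 = \sum_(i in S) s i ^+ 2.
Proof.
have [lW ->] := EX_sqr_sum S L1_xi L1_xi2 xi_mean (pairwise_indep mxi ixi).
by split=> //; apply: eq_bigr => i _; rewrite xi_var.
Qed.

Lemma EX_norm_subsum_le1 S : \sum_(i in S) s i ^+ 2 <= 1 -> \int[P]_w `|W S w| <= 1.
Proof.
move=> s1; have [lW2 EW2] := EX_subsum2 S.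
have : \int[P]_w `|W S w| <= \int[P]_w (2^-1 * (1 + W S w ^+ 2)).
  apply: EX_le.
  - exact/L1_norm/L1_subsum.
  - by apply: L1Z; apply: L1D => //; exact: L1_cst.
  move=> w; rewrite -[W S w ^+ 2]real_normK ?num_real//; move: `|_| => x.
  by have := sqr_ge0 (x - 1); rewrite sqrrB1; lra.
rewrite EXZ; last by apply: L1D => //; exact: L1_cst.
by rewrite EXD ?EX_cst ?EW2//; [lra|exact: L1_cst].
Qed.

(** A minorant of xi_i^2 whose variance is of smaller order: it is at most
    delta |xi_i|. *)
Definition truncated_square delta i w := `|xi i w| * Num.min delta `|xi i w|.

Definition truncated_sum S delta w := \sum_(i in S) truncated_square delta i w.

Lemma measurable_truncated_square delta i :
  measurable_fun setT (truncated_square delta i).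
Proof.
apply: measurable_funM; first exact: measurableT_comp.
by apply: measurable_minr => //; exact: measurableT_comp.
Qed.

Lemma truncated_square_ge0 delta i w : 0 < delta ->
  0 <= truncated_square delta i w.
Proof. by move=> d0; rewrite /truncated_square mulr_ge0// le_min (ltW d0) /=. Qed.

Lemma L1_truncated_square delta i : 0 < delta -> L1 P (truncated_square delta i).
Proof.
move=> d0; apply: (L1_le (measurable_truncated_square delta i) (L1_xi2 i)) => w.
rewrite (ger0_norm (truncated_square_ge0 i w d0)) -[leRHS]real_normK ?num_real//.
by rewrite /truncated_square ler_wpM2l// ge_min lexx orbT.
Qed.

(** The sum has variance at most delta^2 times the sum of the s_i^2, by
    independence; the inequality 2 delta |x| <= x^2 + delta^2 then replaces the
    Cauchy-Schwarz inequality. *)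
Lemma EX_truncated_sum_dev S delta : 0 < delta ->
  \sum_(i in S) s i ^+ 2 <= 1 ->
  \int[P]_w `|truncated_sum S delta w - \int[P]_w' truncated_sum S delta w'| <=
    delta.
Proof.
move=> delta0 sS1; pose H := truncated_sum S delta; rewrite -/H.
set eH := \int[P]_w' H w'.
have meta i := measurable_truncated_square delta i.
have leta i : L1 P (truncated_square delta i) by exact: L1_truncated_square.
have lH : L1 P H by apply: L1_sum.
have eta0 i w : 0 <= truncated_square delta i w by exact: truncated_square_ge0.
pose Z i w := truncated_square delta i w - \int[P]_w' truncated_square delta i w'.
have eta_le i w : truncated_square delta i w <= delta * `|xi i w|.
  by rewrite /truncated_square mulrC ler_wpM2r// ge_min lexx.
have leta2 i : L1 P (fun w => truncated_square delta i w ^+ 2).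
  apply: (L1_le _ (L1Z (delta ^+ 2) (L1_xi2 i))) => [|w]; first exact: measurable_funX.
  rewrite ger0_norm ?sqr_ge0// -[xi i w ^+ 2]real_normK ?num_real// -exprMn.
  by apply: lerXn2r; rewrite ?nnegrE ?eta0 ?eta_le// mulr_ge0// ltW.
have lZ i : L1 P (Z i) by apply: L1B => //; exact: L1_cst.
pose e i := \int[P]_w truncated_square delta i w.
have E2 i : (fun w => Z i w ^+ 2) =
    (fun w => truncated_square delta i w ^+ 2 -
      2 * e i * truncated_square delta i w + e i ^+ 2).
  by apply/funext => w; rewrite /Z /e; ring.
have lZ2 i : L1 P (fun w => Z i w ^+ 2).
  rewrite E2; apply: L1D; last exact: L1_cst.
  by apply: L1B => //; exact: L1Z.
have VZ i : \int[P]_w Z i w ^+ 2 <= delta ^+ 2 * s i ^+ 2.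
  rewrite E2 EXD; [|by apply: L1B => //; exact: L1Z|exact: L1_cst].
  rewrite EXB//; last exact: L1Z.
  rewrite EXZ// EX_cst.
  have : \int[P]_w truncated_square delta i w ^+ 2 <= delta ^+ 2 * s i ^+ 2.
    rewrite -xi_var -EXZ; last exact: L1_xi2.
    apply: EX_le => //; first by apply: L1Z; exact: L1_xi2.
    move=> w; rewrite -[xi i w ^+ 2]real_normK ?num_real// -exprMn.
    by apply: lerXn2r; rewrite ?nnegrE ?eta0 ?eta_le// mulr_ge0// ltW.
  by have := sqr_ge0 (e i); rewrite -/(e i) expr2; lra.
have meta1 : measurable_fun setT (fun x : R => `|x| * Num.min delta `|x|).
  apply: measurable_funM; first exact: normr_measurable.
  by apply: measurable_minr => //; exact: normr_measurable.
have iZ i j : i != j -> indep_pair P (Z i) (Z j).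
  move=> ij; have := pairwise_indep mxi ixi ij.
  pose f k (x : R) := `|x| * Num.min delta `|x| - e k.
  have mf k : measurable_fun setT (f k) by apply: measurable_funB.
  exact: (indep_pair_comp (mf i) (mf j)).
have Z0 i : \int[P]_w Z i w = 0.
  by rewrite EXB ?EX_cst ?subrr//; exact: L1_cst.
have [lS ES] := EX_sqr_sum S lZ lZ2 Z0 iZ.
have HZ : (fun w => (\sum_(i in S) Z i w) ^+ 2) = (fun w => (H w - eH) ^+ 2).
  by apply/funext => w; rewrite /Z sumrB /eH EX_sum.
rewrite HZ in lS ES.
have VS : \int[P]_w (H w - eH) ^+ 2 <= delta ^+ 2.
  rewrite ES; apply: (le_trans (ler_sum _ (fun i _ => VZ i))).
  by rewrite -mulr_sumr -[leRHS]mulr1 ler_wpM2l ?sqr_ge0.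
have : \int[P]_w (2 * delta * `|H w - eH|) <=
    \int[P]_w ((H w - eH) ^+ 2 + delta ^+ 2).
  apply: EX_le.
  - by apply/L1Z/L1_norm/L1B => //; exact: L1_cst.
  - by apply: L1D => //; exact: L1_cst.
  move=> w; rewrite -[(H w - eH) ^+ 2]real_normK ?num_real//; move: `|_| => x.
  by have := sqr_ge0 (x - delta); rewrite sqrrB; lra.
rewrite EXZ; last by apply/L1_norm/L1B => //; exact: L1_cst.
rewrite EXD//; last exact: L1_cst.
rewrite EX_cst => h.
have {}h : 2 * delta * \int[P]_w `|H w - eH| <= 2 * delta * delta by lra.
by rewrite ler_pM2l in h => //; lra.
Qed.

(** Let g be the function x - (a0 + b0) / 2 clipped at l = (b0 - a0) / 2 + beta.
    On the one hand E W g(W) <= l E|W| <= l. On the other hand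
    E W g(W) is the sum of the E xi_i (g(W) - g(W - xi_i)), which is at least
    E 1{a0 <= W <= b0} H with H the sum of the truncated squares. As E H >= 1/2
    and E|H - E H| <= beta, the latter is at least
    P(a0 <= W <= b0) / 2 - beta. *)
Lemma concentration S (beta a0 b0 : R) : 0 < beta -> \sum_(i in S) b i <= beta ->
  3 / 4 <= \sum_(i in S) s i ^+ 2 <= 1 -> a0 <= b0 ->
  fine (P [set w | a0 <= W S w <= b0]) <= (b0 - a0) + 4 * beta.
Proof.
move=> beta0 bS /andP[sS34 sS1] ab.
set l := (b0 - a0) / 2 + beta; set m := (a0 + b0) / 2.
have l0 : 0 <= l by rewrite /l; lra.
pose g (x : R) := clip l (x - m).
have mclip : measurable_fun setT (clip l : R -> R).
  by apply: continuous_measurable_fun; exact: continuous_clip.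
have mg : measurable_fun setT (g : R -> R).
  by apply: measurableT_comp => //; exact: measurable_funB.
have mW S' := measurable_subsum mxi S'.
have gl x : `|g x| <= l by exact: norm_clip_le.
pose I w : bool := a0 <= W S w <= b0.
have mI : measurable_fun setT I.
  by apply: measurable_and; apply: measurable_fun_ler.
have leta i : L1 P (truncated_square beta i) by exact: L1_truncated_square.
pose H := truncated_sum S beta.
have lH : L1 P H by apply: L1_sum.
(* truncating at beta costs at most a quarter: 3/4 - 1/4 = 1/2 *)
have EH : 1 / 2 <= \int[P]_w H w.
  rewrite EX_sum//.
  have E1 i : s i ^+ 2 - b i / (4 * beta) <= \int[P]_w truncated_square beta i w.
    rewrite -xi_var -xi_third [_ / (4 * beta)]mulrC -EXZ// -EXB;
      [|exact: L1_xi2|exact: L1Z].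
    apply: EX_le => //; first by apply: L1B; [exact: L1_xi2|exact: L1Z].
    by move=> w; rewrite -[xi i w ^+ 2]real_normK ?num_real// mulrC; exact: mul_min_ge.
  apply: le_trans (ler_sum _ (fun i _ => E1 i)).
  rewrite sumrB -mulr_suml.
  have : (\sum_(i in S) b i) / (4 * beta) <= 1 / 4.
    by rewrite ler_pdivrMr; lra.
  lra.
set eH := \int[P]_w H w in EH *.
have VH : \int[P]_w `|H w - eH| <= beta by exact: EX_truncated_sum_dev.
have mgW S' : measurable_fun setT (g \o W S') by exact: measurableT_comp.
have lWg : L1 P (fun w => W S w * g (W S w)).
  apply: (@L1M_bounded (W S) (g \o W S) l) => //; first exact: L1_subsum.
  by move=> w; exact: gl.
have up : \int[P]_w (W S w * g (W S w)) <= l.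
  apply: (@le_trans _ _ (\int[P]_w (l * `|W S w|))).
    apply: EX_le => //; first exact/L1Z/L1_norm/L1_subsum.
    move=> w; apply: (le_trans (ler_norm _)).
    by rewrite normrM mulrC ler_wpM2r.
  rewrite EXZ; last exact/L1_norm/L1_subsum.
  by rewrite -[leRHS]mulr1 ler_wpM2l// EX_norm_subsum_le1.
have lI : L1 P (fun w => (I w)%:R) by exact: L1_bool.
have lIH : L1 P (fun w => (I w)%:R * H w).
  apply: (L1_le _ (L1_norm lH)).
    apply: measurable_funM; [exact: measurable_bool_natr|exact: L1_measurable lH].
  by move=> w; rewrite normrM; case: (I w); rewrite ?normr1 ?mul1r ?normr0 ?mul0r.
(* xi_i is centred and independent of W - xi_i, hence g(W - xi_i) may be
   subtracted from g(W) in each term *)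
have low : \int[P]_w ((I w)%:R * H w) <= \int[P]_w (W S w * g (W S w)).
  have lxg i S' : L1 P (fun w => xi i w * g (W S' w)).
    apply: (@L1M_bounded (xi i) (g \o W S') l) => //; first exact: L1_xi.
    by move=> w; exact: gl.
  have lxdg i : L1 P (fun w => xi i w * (g (W S w) - g (W (S :\ i)%SET w))).
    under eq_fun do rewrite mulrBr.
    exact: L1B.
  have -> : \int[P]_w (W S w * g (W S w)) =
      \int[P]_w (\sum_(i in S) xi i w * (g (W S w) - g (W (S :\ i)%SET w))).
    have -> : (fun w => W S w * g (W S w)) =
        (fun w => \sum_(i in S) xi i w * g (W S w)).
      by apply/funext => w; rewrite -mulr_suml.
    rewrite !EX_sum//.
    apply: eq_bigr => i iS.
    under [RHS]eq_Rintegral do rewrite mulrBr.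
    rewrite EXB// [X in _ - X](_ : _ = 0) ?subr0//.
    have := @EXM_indep _ _ _ P (xi i) (g \o W (S :\ i)%SET).
    rewrite xi_mean mul0r; apply => //.
    + apply: (indep_pair_comp (f := id)) => //.
      by apply: subsum_indep => //; rewrite !inE eqxx.
    + exact: L1_xi.
    + by apply: (@L1_bounded _ _ _ _ _ l) => // w; exact: gl.
  apply: EX_le => //.
    by apply: L1_sum => i _; exact: lxdg.
  move=> w; rewrite /H mulr_sumr; apply: ler_sum => i iS.
  have := clip_increment (W S w) (xi i w) ab beta0.
  by have -> : W S w - xi i w = W (S :\ i)%SET w; [rewrite (subsumD1 w iS) addrK|].
have mid : \int[P]_w (eH * (I w)%:R - `|H w - eH|) <= \int[P]_w ((I w)%:R * H w).
  apply: EX_le => //.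
    apply: L1B; first exact: L1Z.
    by apply/L1_norm/L1B => //; exact: L1_cst.
  move=> w; case: (I w); rewrite /= ?mulr1 ?mul1r ?mulr0 ?mul0r ?sub0r ?oppr_le0//.
  by have := ler_norm (eH - H w); rewrite distrC; lra.
rewrite EXB ?EXZ// in mid; [|exact: L1Z|by apply/L1_norm/L1B => //; exact: L1_cst].
have mIs : measurable [set w | I w].
  by have := mI measurableT [set true]; rewrite setTI; apply.
rewrite EX_indicator// in mid.
set p := fine _ in mid *.
have p0 : 0 <= p by rewrite fine_ge0.
have : p / 2 <= eH * p by rewrite mulrC ler_wpM2r//; lra.
by rewrite /l in up; lra.
Qed.

(** The decomposition of P(W <= z) - Phi(z) provided by the Stein equation has
    two sums, of terms T1 and T2; each term is at most
    (2 A + 2) b_i + 4 beta s_i^2 where A is the Lipschitz constant of the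
    derivative. The condition on the third moments makes every s_i at most 1/2,
    so that each W_i keeps variance at least 3/4, as the concentration
    inequality demands. *)
Lemma berry_esseen_small z : \sum_i s i ^+ 2 = 1 -> \sum_i b i <= 1 / 8 ->
  `|fine (P [set w | W [set: 'I_n]%SET w <= z]) - Phi z| <=
    (4 * smooth_const + 12) * \sum_i b i.
Proof.
move=> s1 b8; set beta := \sum_i b i in b8 *.
set A := smooth_const.
have A0 : 0 <= A by exact: smooth_const_ge0.
(* beta = 0 would make all variances vanish *)
have beta0 : 0 < beta.
  rewrite lt_neqAle eq_sym sumr_ge0 ?andbT; last by move=> i _; exact: b_ge0.
  apply: contra_eqN s1 => /eqP beta0.
  rewrite [X in X == _]big1 1?eq_sym ?oner_eq0// => i _.
  have /eqP bi0 : b i == 0.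
    move/eqP: beta0; rewrite psumr_eq0 => [/allP/(_ i)|j _]; last exact: b_ge0.
    by rewrite mem_index_enum; apply.
  have := lyapunov i; rewrite bi0 => si.
  have : s i ^+ 3 == 0 by rewrite eq_le si exprn_ge0.
  by rewrite expf_eq0 /= => /eqP ->; rewrite expr0n.
have b_le i : b i <= beta.
  by rewrite /beta (bigD1 i)//= lerDl sumr_ge0// => j _; exact: b_ge0.
have s_le i : s i <= 1 / 2.
  have h : s i ^+ 3 <= (1 / 2) ^+ 3.
    apply: le_trans (lyapunov i) _; apply: le_trans (b_le i) _.
    by apply: (le_trans b8); rewrite expr_div_n expr1n -natrX.
  by rewrite -(@ler_pXn2r _ 3) ?nnegrE ?s_ge0//; lra.
pose rest i : {set 'I_n} := ([set: 'I_n] :\ i)%SET.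
pose full : {set 'I_n} := [set: 'I_n]%SET.
pose Wt := W [set: 'I_n]%SET.
pose Wi i := W (rest i).
have WE i w : Wt w = Wi i w + xi i w by rewrite /Wt (@subsumD1 _ i) ?inE.
have mW S := measurable_subsum mxi S.
have mWt : measurable_fun setT Wt by exact: mW.
have mWi i : measurable_fun setT (Wi i) by exact: mW.
pose f : R -> R := stein z.
pose D : R -> R := dstein z.
have mf : measurable_fun setT f.
  by apply: continuous_measurable_fun; exact: continuous_stein.
have mD : measurable_fun setT D.
  apply: measurable_funB => //; apply: measurable_funD; first exact: measurable_funM.
  by apply: measurable_bool_natr; exact: measurable_fun_ler.
have iWi i : indep_pair P (xi i) (Wi i) by apply: subsum_indep => //; rewrite !inE eqxx.
have sWi i : 3 / 4 <= \sum_(j in rest i) s j ^+ 2 <= 1.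
  have : \sum_(j in full) s j ^+ 2 = 1.
    by rewrite -[RHS]s1; apply: eq_bigl => j; rewrite inE.
  rewrite (big_setD1 i) ?inE//= -/(rest i) => h.
  have h2 : s i ^+ 2 <= 1 / 4.
    by have := s_ge0 i; have := s_le i; nra.
  have := sqr_ge0 (s i); lra.
have bWi i : \sum_(j in rest i) b j <= beta.
  rewrite /beta [leRHS](bigID (fun j => j \in (rest i)))/= lerDl sumr_ge0// => j _.
  exact: b_ge0.
have conc i r : 0 <= r -> fine (P [set w | (`|Wi i w - z| <= r)%R]) <= 2 * r + 4 * beta.
  move=> r0; have := @concentration _ _ (z - r) (z + r) beta0 (bWi i) (sWi i).
  have -> : z + r - (z - r) = 2 * r by ring.
  have -> : [set w | (`|Wi i w - z| <= r)%R] = [set w | (z - r <= Wi i w <= z + r)%R].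
    by apply/funext => w /=; rewrite ler_distl.
  by apply; lra.
(* the event that the jump of the derivative lies within reach of xi_i *)
pose N i w : bool := `|Wi i w - z| <= `|xi i w|.
have mN i : measurable_fun setT (N i).
  apply: measurable_fun_ler; apply: measurableT_comp => //.
  exact: measurable_funB.
have lN i : L1 P (fun w => (N i w)%:R) by exact: L1_bool.
pose q (x : R) := 2 * `|x| + 4 * beta.
have lq i : L1 P (fun w => q (xi i w)).
  by apply: L1D; [apply/L1Z/L1_norm/L1_xi|exact: L1_cst].
have mNz : measurable_fun setT (fun y : R * R => (`|y.2 - z| <= `|y.1|)%R).
  apply: measurable_fun_ler.
    by apply: measurableT_comp => //; apply: measurable_funB.
  by apply: measurableT_comp.
have EN i : \int[P]_w (N i w)%:R <= 2 * \int[P]_w `|xi i w| + 4 * beta.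
  have := @EX_section_le _ _ _ P _ _ (mxi i) (mWi i) (iWi i)
    (cst 1) (fun x y => `|y - z| <= `|x|) q.
  rewrite /= => /(_ _ mNz) h.
  have : \int[P]_w (1 * (N i w)%:R) <= \int[P]_w (1 * q (xi i w)).
    apply: h => //; [by move=> x; apply: conc|exact: L1_cst|exact: L1Z].
  rewrite EXZ// EXZ// !mul1r /q EXD; [|exact/L1Z/L1_norm/L1_xi|exact: L1_cst].
  by rewrite (EXZ 2 (L1_norm (L1_xi i))) EX_cst.
have lxN i : L1 P (fun w => xi i w ^+ 2 * (N i w)%:R).
  apply: (@L1M_bounded _ _ 1); [exact: L1_xi2|exact: measurable_bool_natr|].
  by move=> w; case: (N i w); rewrite ?normr1 ?normr0.
have ExN i : \int[P]_w (xi i w ^+ 2 * (N i w)%:R) <= 2 * b i + 4 * beta * s i ^+ 2.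
  have E : (fun w => xi i w ^+ 2 * q (xi i w)) =
      (fun w => 2 * `|xi i w| ^+ 3 + 4 * beta * xi i w ^+ 2).
    by apply/funext => w; rewrite /q -[xi i w ^+ 2]real_normK ?num_real//; ring.
  have lE : L1 P (fun w => xi i w ^+ 2 * q (xi i w)).
    by rewrite E; apply: L1D; apply: L1Z => //; exact: L1_xi2.
  have := @EX_section_le _ _ _ P _ _ (mxi i) (mWi i) (iWi i)
    (fun x => x ^+ 2) (fun x y => `|y - z| <= `|x|) q.
  rewrite /= => /(_ _ mNz) h.
  apply: (le_trans (h _ _ _ _ _)) => //.
  - by move=> x; rewrite sqr_ge0.
  - by move=> x; apply: conc.
  - exact: L1_xi2.
  rewrite E EXD; [|exact: L1Z|by apply: L1Z; exact: L1_xi2].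
  by rewrite (EXZ 2 (lxi3 i)) (EXZ (4 * beta) (L1_xi2 i)) xi_third xi_var.
have EWi i : \int[P]_w (1 + `|Wi i w|) <= 2.
  rewrite EXD; [|exact: L1_cst|exact/L1_norm/L1_subsum].
  rewrite EX_cst; have := @EX_norm_subsum_le1 (rest i).
  by case/andP: (sWi i) => _ h /(_ h); rewrite /Wi; lra.
have lWi i : L1 P (fun w => 1 + `|Wi i w|).
  by apply: L1D; [exact: L1_cst|exact/L1_norm/L1_subsum].
(* the Lipschitz constant of the derivative grows like 1 + |W_i|, whose mean is
   at most 2 and which is independent of xi_i *)
have prodk i k : L1 P (fun w => `|xi i w| ^+ k) ->
    L1 P (fun w => `|xi i w| ^+ k * (1 + `|Wi i w|)) /\
    \int[P]_w (`|xi i w| ^+ k * (1 + `|Wi i w|)) <= 2 * \int[P]_w `|xi i w| ^+ k.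
  move=> lk.
  have m1 : measurable_fun setT (fun x : R => `|x| ^+ k) by exact: measurable_funX.
  have m2 : measurable_fun setT (fun x : R => 1 + `|x|) by exact: measurable_funD.
  have ind := indep_pair_comp m1 m2 (iWi i).
  have mm1 := measurableT_comp m1 (mxi i).
  have mm2 := measurableT_comp m2 (mWi i).
  split; first exact: (L1M_indep mm1 mm2 ind lk (lWi i)).
  have /= -> := EXM_indep mm1 mm2 ind lk (lWi i).
  by rewrite mulrC ler_wpM2r// EX_ge0// => w; rewrite exprn_ge0.
have lD u : measurable_fun setT u -> L1 P (fun w => D (u w)).
  move=> mu; apply: (@L1_bounded _ _ _ _ _ 2); first exact: measurableT_comp.
  by move=> w; exact: norm_dstein_le.
have T1 i : `|s i ^+ 2 * (\int[P]_w D (Wt w) - \int[P]_w D (Wi i w))| <=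
    (2 * A + 2) * b i + 4 * beta * s i ^+ 2.
  have l1 : L1 P (fun w => `|xi i w| ^+ 1).
    by under eq_fun do rewrite expr1; exact/L1_norm/L1_xi.
  have [lp Ep] := prodk i 1%N l1.
  have : `|\int[P]_w D (Wt w) - \int[P]_w D (Wi i w)| <=
     \int[P]_w (A * (`|xi i w| ^+ 1 * (1 + `|Wi i w|)) + (N i w)%:R).
    rewrite -EXB; [|exact: lD..].
    apply: (le_trans (EX_norm _)); first by apply: L1B; exact: lD.
    apply: EX_le.
    - by apply/L1_norm/L1B; exact: lD.
    - by apply: L1D => //; exact: L1Z.
    move=> w; rewrite (WE i); apply: (le_trans (dstein_variation z (Wi i w) (xi i w))).
    by rewrite expr1 -/A -mulrA [`|xi i w| * _]mulrC.
  rewrite (EXD (L1Z A lp) (lN i)) (EXZ A lp) => h.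
  have h2 : A * \int[P]_w (`|xi i w| ^+ 1 * (1 + `|Wi i w|)) <=
      A * (2 * \int[P]_w `|xi i w|).
    by rewrite ler_wpM2l.
  have h3 : `|\int[P]_w D (Wt w) - \int[P]_w D (Wi i w)| <=
      (2 * A + 2) * \int[P]_w `|xi i w| + 4 * beta.
    by have := EN i; lra.
  rewrite normrM (ger0_norm (sqr_ge0 _)).
  apply: (le_trans (ler_wpM2l (sqr_ge0 _) h3)).
  have := ler_wpM2l (_ : 0 <= 2 * A + 2) (sqr_mean_le i).
  by move=> /(_ ltac:(lra)); lra.
have lxf i u : measurable_fun setT u -> L1 P (fun w => xi i w * f (u w)).
  move=> mu; apply: (@L1M_bounded _ (f \o u) stein_const).
  - exact: L1_xi.
  - exact: measurableT_comp.
  - by move=> w; exact: norm_stein_le.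
have lxD i : L1 P (fun w => xi i w ^+ 2 * D (Wi i w)).
  apply: (@L1M_bounded _ (D \o Wi i) 2).
  - exact: L1_xi2.
  - exact: measurableT_comp.
  - by move=> w; exact: norm_dstein_le.
have T2 i : `|\int[P]_w (xi i w * f (Wt w)) - s i ^+ 2 * \int[P]_w D (Wi i w)| <=
    (2 * A + 2) * b i + 4 * beta * s i ^+ 2.
  have [lp Ep] := prodk i 3%N (lxi3 i).
  have e1 : \int[P]_w (xi i w * f (Wi i w)) = 0.
    have := @EXM_indep _ _ _ P (xi i) (f \o Wi i); rewrite xi_mean mul0r; apply => //.
    + exact: measurableT_comp.
    + exact: (indep_pair_comp (f := id)).
    + exact: L1_xi.
    + apply: (@L1_bounded _ _ _ _ _ stein_const); first exact: measurableT_comp.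
      by move=> w; exact: norm_stein_le.
  have e2 : \int[P]_w (xi i w ^+ 2 * D (Wi i w)) = s i ^+ 2 * \int[P]_w D (Wi i w).
    have mX : measurable_fun setT (fun x : R => x ^+ 2) by exact: measurable_funX.
    have := @EXM_indep _ _ _ P ((fun x => x ^+ 2) \o xi i) (D \o Wi i).
    rewrite xi_var; apply => //.
    + exact: measurableT_comp.
    + exact: measurableT_comp.
    + exact: indep_pair_comp.
    + exact: L1_xi2.
    + exact: lD.
  have -> : \int[P]_w (xi i w * f (Wt w)) - s i ^+ 2 * \int[P]_w D (Wi i w) =
     \int[P]_w (xi i w * f (Wt w) - xi i w * f (Wi i w) - xi i w ^+ 2 * D (Wi i w)).
    have l1 := lxf i _ mWt; have l2 := lxf i _ (mWi i).
    by rewrite (EXB (L1B l1 l2) (lxD i)) (EXB l1 l2) e1 e2 subr0.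
  have ll : L1 P (fun w =>
      xi i w * f (Wt w) - xi i w * f (Wi i w) - xi i w ^+ 2 * D (Wi i w)).
    by apply: L1B => //; apply: L1B; exact: lxf.
  apply: (le_trans (EX_norm ll)).
  apply: (@le_trans _ _ (\int[P]_w
      (A * (`|xi i w| ^+ 3 * (1 + `|Wi i w|)) + xi i w ^+ 2 * (N i w)%:R))).
    apply: EX_le; first exact: L1_norm.
    - by apply: L1D => //; exact: L1Z.
    move=> w; rewrite (WE i).
    have -> : xi i w * f (Wi i w + xi i w) - xi i w * f (Wi i w) -
        xi i w ^+ 2 * D (Wi i w) =
       xi i w * (f (Wi i w + xi i w) - f (Wi i w) - xi i w * D (Wi i w)) by ring.
    have := stein_expansion z (Wi i w) (xi i w).
    rewrite normrM => /(ler_wpM2l (normr_ge0 (xi i w)))/le_trans; apply.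
    rewrite -[xi i w ^+ 2]real_normK ?num_real// -/A /N.
    by rewrite le_eqVlt; apply/orP; left; apply/eqP; ring.
  rewrite (EXD (L1Z A lp) (lxN i)) (EXZ A lp).
  have := ler_wpM2l A0 Ep; rewrite xi_third.
  by have := ExN i; lra.
have mle : measurable_fun setT (fun w => (Wt w <= z)%R) by exact: measurable_fun_ler.
have E0 : fine (P [set w | Wt w <= z]) - Phi z =
    \int[P]_w D (Wt w) - \sum_i \int[P]_w (xi i w * f (Wt w)).
  rewrite -EX_sum; last by move=> i _; exact: lxf.
  rewrite -EXB; [|exact: lD|by apply: L1_sum => i _; exact: lxf].
  have -> : (fun w => D (Wt w) - \sum_i xi i w * f (Wt w)) =
      (fun w => (Wt w <= z)%R%:R - Phi z).
    apply/funext => w; rewrite -mulr_suml.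
    have -> : \sum_i xi i w = Wt w by apply: eq_bigl => i; rewrite inE.
    by rewrite /D /dstein /f; ring.
  rewrite EXB ?EX_cst ?EX_indicator//; [|exact: L1_bool|exact: L1_cst].
  by have := mle measurableT [set true]; rewrite setTI; apply.
rewrite E0 -[X in `|X - _|]mul1r -s1 mulr_suml -sumrB.
apply: (le_trans (ler_norm_sum _ _ _)).
pose term i := (2 * A + 2) * b i + 4 * beta * s i ^+ 2.
apply: (@le_trans _ _ (\sum_i (term i + term i))).
  apply: ler_sum => i _.
  have -> : s i ^+ 2 * \int[P]_w D (Wt w) - \int[P]_w (xi i w * f (Wt w)) =
    s i ^+ 2 * (\int[P]_w D (Wt w) - \int[P]_w D (Wi i w)) -
    (\int[P]_w (xi i w * f (Wt w)) - s i ^+ 2 * \int[P]_w D (Wi i w)) by ring.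
  by apply: (le_trans (ler_normB _ _)); exact: lerD.
by rewrite !big_split/= -!mulr_sumr s1 -/beta; lra.
Qed.

(** Twelve is 8 + 4: concentration is used in T1 and T2, each time giving 4 beta
    times the total variance and 2 b_i; the constant also exceeds 8, which
    settles the case of third moments adding up to more than 1/8. *)
Definition berry_esseen_const : R := 4 * smooth_const + 12.

(** When the third moments add up to more than 1/8, the right-hand side exceeds 1
    and the inequality is trivial. *)
Theorem berry_esseen z : \sum_i s i ^+ 2 = 1 ->
  `|fine (P [set w | \sum_i xi i w <= z]) - Phi z| <= berry_esseen_const * \sum_i b i.
Proof.
move=> s1.
have -> : [set w | \sum_i xi i w <= z] = [set w | W [set: 'I_n]%SET w <= z].
  have E w : W [set: 'I_n]%SET w = \sum_i xi i w.
    by apply: eq_bigl => i; rewrite inE.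
  by apply/seteqP; split => w /=; rewrite E.
have [b8|b8] := leP (\sum_i b i) (1 / 8).
  exact: berry_esseen_small.
apply: (@le_trans _ _ 1); last first.
  by have := @smooth_const_ge0 R; rewrite /berry_esseen_const; nra.
have := Phi_ge0 z; have := Phi_le1 z.
set p := fine _.
have p0 : 0 <= p by rewrite fine_ge0.
have p1 : p <= 1.
  have mA : measurable [set w | W [set: 'I_n]%SET w <= z].
    have := measurable_fun_ler (measurable_subsum mxi [set: 'I_n]%SET)
      (measurable_cst z).
    by move=> /(_ measurableT [set true]); rewrite setTI; apply.
  by rewrite -lee_fin /p fineK ?probability_le1// fin_num_measure.
by rewrite ler_norml; lra.
Qed.

End BerryEsseen.

(** * Weighted sums of i.i.d. variables and the sign group *)

Section Weighted.
Context d (Omega : measurableType d) (R : realType) (P : probability Omega R).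
Variables (n : nat) (X : 'I_n -> {RV P >-> R}) (sigma omega : R).
Hypotheses (sigma_gt0 : 0 < sigma) (iidX : iid_centered P X sigma omega).

Let mX i : measurable_fun setT (X i : Omega -> R).
Proof. exact: measurable_funPT. Qed.

Lemma iid_L1_third i : L1 P (fun w => `|X i w| ^+ 3).
Proof.
have [_ _ _ _ /(_ i)] := iidX; rewrite unlock => E3.
apply/integrableP; split.
  by apply/measurable_EFinP; apply: measurable_funX; exact: measurableT_comp.
under eq_integral => w _.
  rewrite /= ger0_norm ?exprn_ge0//; over.
by rewrite E3 ltry.
Qed.

Lemma iid_third i : \int[P]_w `|X i w| ^+ 3 = omega.
Proof. by have [_ _ _ _ /(_ i)] := iidX; rewrite unlock /Rintegral => ->. Qed.

Lemma iid_mean i : \int[P]_w X i w = 0.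
Proof. by have [_ _ /(_ i) + _ _] := iidX; rewrite unlock /Rintegral => ->. Qed.

Lemma iid_var i : \int[P]_w X i w ^+ 2 = sigma ^+ 2.
Proof.
have [_ _ /(_ i) E1 /(_ i) + _] := iidX; rewrite /variance covariance.unlock E1 /= => h.
rewrite /Rintegral -[RHS]/(fine (sigma ^+ 2)%:E) -h unlock; congr fine.
by apply: eq_integral => w _; rewrite /= !mulrfctE/= subr0 expr2.
Qed.

Variable c : 'I_n -> R.
Hypothesis c1 : \sum_i c i ^+ 2 = 1.

Let xi i (w : Omega) := c i / sigma * X i w.

Lemma indep_family_scaled : indep_family P xi.
Proof.
move=> J A mA; have [iX _ _ _ _] := iidX.
apply: (iX J (fun i => (fun x => c i / sigma * x) @^-1` A i)) => i.
have mc : measurable_fun setT (fun x : R => c i / sigma * x) by exact: measurable_funM.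
by rewrite -[X in measurable X]setTI; exact: mc.
Qed.

(** The variables c_i X_i / sigma have variances c_i^2 and third absolute moments
    |c_i|^3 omega / sigma^3. *)
Lemma weighted_berry_esseen t :
  `|fine (P [set w | t < \sum_i c i * X i w]) - (1 - Phi (t / sigma))| <=
    berry_esseen_const * (omega / sigma ^+ 3 * \sum_i `|c i| ^+ 3).
Proof.
have sne : sigma != 0 by rewrite gt_eqF.
have mxi i : measurable_fun setT (xi i) by exact: measurable_funM.
have lX i : L1 P (X i) by exact: (L1_xi mX iid_L1_third).
have lX2 i : L1 P (fun w => X i w ^+ 2) by exact: (L1_xi2 mX iid_L1_third).
have E3 i : (fun w => `|xi i w| ^+ 3) =
    (fun w => (`|c i| / sigma) ^+ 3 * `|X i w| ^+ 3).
  by apply/funext => w; rewrite /xi !normrM normfV (gtr0_norm sigma_gt0) exprMn.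
have E2 i : (fun w => xi i w ^+ 2) = (fun w => (c i / sigma) ^+ 2 * X i w ^+ 2).
  by apply/funext => w; rewrite exprMn.
have lxi3 i : L1 P (fun w => `|xi i w| ^+ 3).
  by rewrite E3; apply: L1Z; exact: iid_L1_third.
have xi_mean i : \int[P]_w xi i w = 0 by rewrite EXZ// iid_mean mulr0.
have xi_var i : \int[P]_w xi i w ^+ 2 = `|c i| ^+ 2.
  by rewrite E2 EXZ// iid_var real_normK ?num_real//; field.
have xi_third i : \int[P]_w `|xi i w| ^+ 3 = (`|c i| / sigma) ^+ 3 * omega.
  by rewrite E3 EXZ ?iid_third//; exact: iid_L1_third.
have := @berry_esseen _ _ _ P n xi _ _ mxi indep_family_scaled
  lxi3 xi_mean xi_var xi_third (fun i => normr_ge0 _) (t / sigma).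
have -> : \sum_i `|c i| ^+ 2 = 1.
  by rewrite -[RHS]c1; apply: eq_bigr => i _; rewrite real_normK ?num_real.
move=> /(_ erefl).
have -> : \sum_i (`|c i| / sigma) ^+ 3 * omega =
    omega / sigma ^+ 3 * \sum_i `|c i| ^+ 3.
  by rewrite mulr_sumr; apply: eq_bigr => i _; field.
have -> : [set w | \sum_i xi i w <= t / sigma] = ~` [set w | t < \sum_i c i * X i w].
  have xiE w : \sum_i xi i w = (\sum_i c i * X i w) / sigma.
    by rewrite mulr_suml; apply: eq_bigr => i _; rewrite /xi mulrAC.
  apply/seteqP; split => w /=; rewrite xiE ler_pM2r ?invr_gt0//.
    by move=> h; apply/negP; rewrite -leNgt.
  by move/negP; rewrite -leNgt.
have mA : measurable [set w | t < \sum_i c i * X i w].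
  have mS : measurable_fun setT (fun w => \sum_i c i * X i w).
    by apply: measurable_sum => i; exact: measurable_funM.
  have := measurable_fun_ltr (measurable_cst t) mS.
  by move=> /(_ measurableT [set true]); rewrite setTI; apply.
rewrite probability_setC// fineB ?fin_num_measure//= => h.
rewrite -normrN (le_trans _ h)// le_eqVlt; apply/orP; left; apply/eqP.
by congr `|_|; ring.
Qed.
End Weighted.

(** The proportion of sign vectors g with T(pi_g X) > t has expectation the
    average over g of P(T(pi_g X) > t), and every one of these probabilities
    obeys the bound of [weighted_berry_esseen] with the same right-hand side. *)
Lemma discrepancy_le d (Omega : measurableType d) (R : realType)
    (P : probability Omega R) (n : nat) (X : 'I_n -> {RV P >-> R})
    (sigma omega : R) (theta : 'rV[R]_n) t : 0 < sigma ->
  iid_centered P X sigma omega -> \sum_(i < n) theta 0 i ^+ 2 = 1 ->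
  (discrepancy P X theta t <= (error_bound berry_esseen_const sigma omega theta)%:E)%E.
Proof.
move=> sigma_gt0 iidX theta1.
pose K : R := omega / sigma ^+ 3 * \sum_i `|theta 0 i| ^+ 3.
pose c (g : signs n) i : R := theta 0 i * (-1) ^+ g i.
pose A (g : signs n) := [set w | t < \sum_i c g i * X i w].
have c_norm g i : `|c g i| = `|theta 0 i| by rewrite normrM normrX normrN1 expr1n mulr1.
have c1 g : \sum_i c g i ^+ 2 = 1.
  rewrite -[RHS]theta1; apply: eq_bigr => i _.
  by rewrite -[LHS]real_normK ?num_real// c_norm real_normK ?num_real.
have BEg g : `|fine (P (A g)) - (1 - Phi (t / sigma))| <= berry_esseen_const * K.
  have := weighted_berry_esseen sigma_gt0 iidX (c1 g) t.
  by under eq_bigr do rewrite c_norm.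
have BE : `|fine (P [set w | t < \sum_i theta 0 i * X i w]) -
    (1 - Phi (t / sigma))| <= berry_esseen_const * K.
  exact: (weighted_berry_esseen (c := fun i => theta 0 i) sigma_gt0 iidX).
have mS (a : 'I_n -> R) : measurable [set w | t < \sum_i a i * X i w].
  have mS : measurable_fun setT (fun w => \sum_i a i * X i w).
    apply: measurable_sum => i.
    by apply: measurable_funM => //; exact: measurable_funPT.
  have := measurable_fun_ltr (measurable_cst t) mS.
  by move=> /(_ measurableT [set true]); rewrite setTI; apply.
have stat a w : lin_stat a (rvec X w) = \sum_i a 0 i * X i w.
  by apply: eq_bigr => i _; rewrite !mxE.
have statg g w : lin_stat theta (sign_act g (rvec X w)) = \sum_i c g i * X i w.
  by apply: eq_bigr => i _; rewrite !mxE mulrA.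
pose N : R := #|[set: signs n]%SET|%:R.
have N0 : 0 < N by rewrite ltr0n; apply/card_gt0P; exists 1%g; rewrite inE.
have rhoE w :
    rho R [set g : signs n | t < lin_stat theta (sign_act g (rvec X w))]%SET =
    N^-1 * \sum_(g : signs n) (t < \sum_i c g i * X i w)%R%:R.
  rewrite /rho mulrC -/N; congr (_ * _); rewrite -sum1_card natr_sum big_mkcond /=.
  by apply: eq_bigr => g _; rewrite inE statg; case: ifP.
have lA g : L1 P (fun w => (t < \sum_i c g i * X i w)%R%:R).
  apply: L1_bool; apply: measurable_fun_ltr => //.
  by apply: measurable_sum => i; apply: measurable_funM => //; exact: measurable_funPT.
have Erho : ('E_P[(fun w => rho R
      [set g : signs n | t < lin_stat theta (sign_act g (rvec X w))]%SET)%R] =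
    (N^-1 * \sum_(g : signs n) fine (P (A g)))%:E)%E.
  rewrite unlock; under eq_integral do rewrite rhoE.
  rewrite -EX_fin; last by apply: L1Z; apply: L1_sum.
  rewrite EXZ; last by apply: L1_sum.
  rewrite EX_sum//; congr (_ * _)%:E; apply: eq_bigr => g _.
  by rewrite EX_indicator.
rewrite /discrepancy Erho.
have -> : [set w | t < lin_stat theta (rvec X w)] =
    [set w | t < \sum_i theta 0 i * X i w].
  by apply/funext => w /=; rewrite stat.
rewrite -[X in (X - _)%E]fineK ?fin_num_measure// -EFinB abse_EFin lee_fin.
set p := fine _ in BE *.
have -> : p - N^-1 * \sum_(g : signs n) fine (P (A g)) =
    N^-1 * \sum_(g : signs n) (p - fine (P (A g))).
  rewrite sumrB sumr_const mulrBr -mulr_natr mulrCA.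
  have -> : #|signs n|%:R = N by rewrite /N cardsT.
  by rewrite mulVf ?mulr1 ?gt_eqF.
have Ni : 0 <= N^-1 by rewrite invr_ge0 ltW.
rewrite normrM (ger0_norm Ni) ler_pdivrMl//.
apply: (le_trans (ler_norm_sum _ _ _)).
have -> : N * error_bound berry_esseen_const sigma omega theta =
    \sum_(g : signs n) (2 * (berry_esseen_const * K)).
  rewrite sumr_const -[RHS]mulr_natl.
  have -> : #|signs n|%:R = N by rewrite /N cardsT.
  by rewrite /error_bound /K; congr (_ * _); rewrite !mulrA.
apply: ler_sum => g _.
have -> : p - fine (P (A g)) =
  (p - (1 - Phi (t / sigma))) - (fine (P (A g)) - (1 - Phi (t / sigma))) by ring.
by apply: (le_trans (ler_normB _ _)); have := BEg g; lra.
Qed.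

Lemma berry_esseen_const_gt0 (R : realType) : 0 < berry_esseen_const :> R.
Proof. by have := @smooth_const_ge0 R; rewrite /berry_esseen_const; lra. Qed.

Unset Implicit Arguments.

Theorem theorem4p1 (R : realType) :
  exists C : R, [/\ 0 < C,
    forall (d : measure_display) (Omega : measurableType d)
      (P : probability Omega R) (n : nat) (X : 'I_n -> {RV P >-> R})
      (sigma omega : R) (theta : 'rV[R]_n),
      0 < sigma -> iid_centered P X sigma omega ->
      \sum_(i < n) theta 0 i ^+ 2 = 1 ->
      forall t : R,
        (discrepancy P X theta t <= (error_bound C sigma omega theta)%:E)%E,
    forall (d : nat -> measure_display)
      (Omega : forall n, measurableType (d n))
      (P : forall n, probability (Omega n) R)
      (X : forall n, 'I_n -> {RV (P n) >-> R})
      (sigma omega : R) (theta : forall n, 'rV[R]_n),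
      0 < sigma -> (forall n, iid_centered (P n) (X n) sigma omega) ->
      (forall n, (0 < n)%N -> \sum_(i < n) theta n 0 i ^+ 2 = 1) ->
      (\sum_(i < n) `|theta n 0 i| ^+ 3) @[n --> \oo] --> (0 : R) ->
      forall t : nat -> R,
        discrepancy (P n) (X n) (theta n) (t n) @[n --> \oo] --> 0%E
  & forall sigma omega : R, 0 < sigma ->
      (fun n : nat => error_bound C sigma omega
         (\row_(i < n) ((Num.sqrt (n%:R : R))^-1)%R)) =O_\oo
      (fun n : nat => ((Num.sqrt (n%:R : R))^-1)%R)].
Proof.
exists berry_esseen_const; split; first exact: berry_esseen_const_gt0.
- by move=> d Omega P n X sigma omega theta s0 iX t1 t; exact: discrepancy_le.
- move=> d Omega P X sigma omega theta s0 iX t1 t3 t.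
  apply: (@squeeze_cvge _ _ _ _ (cst 0%E) _
    (fun n => (error_bound berry_esseen_const sigma omega (theta n))%:E)).
  + near=> n; rewrite abse_ge0/=; apply: discrepancy_le => //; apply: t1.
    by near: n; exact: nbhs_infty_gt.
  + exact: cvg_cst.
  + apply: cvg_EFin; first by near=> n.
    pose K : R := 2 * berry_esseen_const * omega / sigma ^+ 3.
    rewrite /error_bound -[X in _ --> X](mulr0 K).
    exact: cvgMl_tmp.
- move=> sigma omega s0; apply/eqO_exP.
  pose K : R := 2 * berry_esseen_const * omega / sigma ^+ 3.
  exists (`|K| + 1); first by rewrite ltr_wpDl.
  near=> n; have n0 : (0 < n)%N by near: n; exact: nbhs_infty_gt.
  have q0 : 0 < Num.sqrt (n%:R : R) by rewrite sqrtr_gt0 ltr0n.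
  rewrite /error_bound -/K.
  under eq_bigr do rewrite mxE.
  rewrite sumr_const card_ord.
  have -> : `|(Num.sqrt (n%:R : R))^-1| ^+ 3 *+ n = (Num.sqrt n%:R)^-1.
    rewrite gtr0_norm ?invr_gt0// -[_ *+ n]mulr_natr.
    rewrite -[X in _ * X](sqr_sqrtr (ler0n R n)).
    by field; rewrite gt_eqF.
  by rewrite normrM ler_wpM2r// lerDl.
Unshelve. all: by end_near. Qed.
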